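(* For every $k\ge 3$ and $\ell\ge k+1$, $\delta_{P_\ell^{(k)}}=1/2$.
   Context: A $k$-graph is a $k$-uniform hypergraph. For $\ell>k\ge 2$, the tight path $P_\ell^{(k)}$ on $\ell$ vertices is the $k$-graph with vertices $v_1,\dots,v_\ell$ and edges $\{v_i,v_{i+1},\dots,v_{i+k-1}\}$ for $i\in\{1,\dots,\ell-k+1\}$. $\delta_{k-1}(H)$ is the minimum, over all $(k-1)$-sets $S\subseteq V(H)$, of the number of edges of $H$ containing $S$. A $P_\ell^{(k)}$-decomposition of $H$ is a collection of subgraphs of $H$, each isomorphic to $P_\ell^{(k)}$, covering every edge of $H$ exactly once. $H$ is $P_\ell^{(k)}$-divisible if $|E(H)|$ is divisible by $|E(P_\ell^{(k)})|=\ell-k+1$. The $P_\ell^{(k)}$-decomposition threshold $\delta_{P_\ell^{(k)}}$ is the least $d>0$ such that for every $\varepsilon>0$ there exists $n_0$ such that any $P_\ell^{(k)}$-divisible $k$-graph $H$ on $n\ge n_0$ vertices with $\delta_{k-1}(H)\ge(d+\varepsilon)n$ admits a $P_\ell^{(k)}$-decomposition. *)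

(* Defs.v *)
From HB Require Import structures.
From mathcomp Require Import all_boot all_order all_algebra.
From mathcomp Require Import reals.

Set Implicit Arguments.
Unset Strict Implicit.
Unset Printing Implicit Defensive.

Import Order.TTheory GRing.Theory Num.Theory.

Local Open Scope ring_scope.

(* A hypergraph on the whole of a finite type V is given by its edge set;
   a hypergraph whose vertex set is only part of V is a pair
   (vertex set, edge set). *)
Notation edge_set V := {set {set V}}.
Notation part_graph V := ({set V} * {set {set V}})%type.

Definition uniform (k : nat) (V : finType) (E : edge_set V) : Prop :=
  forall e : {set V}, e \in E -> #|e| = k.

Definition degree (V : finType) (E : edge_set V) (S : {set V}) : nat :=
  #|[set e in E | S \subset e]|.

(* The initial value #|E| bounds every degree from above, so it affects the
   minimum only when V has no subset of size j at all. *)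
Definition min_degree (j : nat) (V : finType) (E : edge_set V) : nat :=
  \big[minn/#|E|]_(S : {set V} | #|S| == j) degree E S.

(* Vertices are numbered from 0; for k <= l there are l - k + 1 edges
   {i, ..., i + k - 1}, with i running over 0, ..., l - k. *)
Definition tight_path (k l : nat) : edge_set 'I_l :=
  [set [set v : 'I_l | (i <= v < i + k)%N] | i : 'I_(l - k + 1)].

Definition subgraph (V : finType) (G : part_graph V) (E : edge_set V) : Prop :=
  G.2 \subset E /\ forall e : {set V}, e \in G.2 -> e \subset G.1.

(* The map f is a bijection from T onto G.1 carrying the edges in P exactly
   to those of G. *)
Definition is_copy (T V : finType) (P : edge_set T) (G : part_graph V) : Prop :=
  exists f : T -> V,
    [/\ injective f,
        [set f x | x in [set: T]] = G.1 &
        [set f @: e | e : {set T} in P] = G.2].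

Definition decomposition (T V : finType) (P : edge_set T) (E : edge_set V)
    (D : {set part_graph V}) : Prop :=
  (forall G : part_graph V, G \in D -> subgraph G E /\ is_copy P G) /\
  (forall e : {set V}, e \in E -> #|[set G in D | e \in G.2]| = 1%N).

Definition path_divisible (k l : nat) (V : finType) (E : edge_set V) : Prop :=
  (#|tight_path k l| %| #|E|)%N.

Definition forces_decomposition (R : realType) (k l : nat) (d : R) : Prop :=
  forall eps : R, 0 < eps ->
  exists n0 : nat,
  forall (V : finType) (E : edge_set V),
    uniform k E -> (n0 <= #|V|)%N -> path_divisible k l E ->
    (d + eps) * #|V|%:R <= (min_degree k.-1 E)%:R ->
    exists D : {set part_graph V}, decomposition (tight_path k l) E D.

Definition is_decomposition_threshold (R : realType) (k l : nat) (d : R) : Prop :=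
  [/\ 0 < d, forces_decomposition k l d &
      forall d' : R, 0 < d' -> forces_decomposition k l d' -> d <= d'].

(* Main.v *)
(* Upper bound.  Call an uncovered edge a token at each of the (k-1)-sets it contains, and
   let m = l - k + 1.  A maximal packing of paths leaves a k-graph without tight paths on
   l vertices, hence with at most l tokens assigned to each (k-1)-set.  Before packing,
   reserve for each (k-1)-set S boundedly many edge-disjoint gadgets of two kinds: one
   absorbs any m tokens at S, the other trades a token at S for a token at a set T obtained
   from S by replacing one vertex.  Both come from long tight paths that start at S: if a
   token is put in front of such a path, cutting the result into pieces of m edges frees
   the last edge.  Codegree above n/2 gives S and T many common neighbours, so that paths
   from S and from T reach a common dense k-graph F.  To trade, go from S to an edge of F
   and back to T; to absorb, free the m edges of a tight path inside F.  Gadgets have order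
   n^N choices, only O(n^(N-1)) of them conflict with a given one, so a conflict-free choice
   exists.  The moves S -> T are chosen to form a tree; each S passes to its parent the
   residue mod m of its number of tokens, and divisibility makes the root end with residue 0.

   Lower bound.  Split the vertices into halves X, Y and take the edges meeting X in an even
   number of vertices.  Consecutive edges of a tight path share k - 1 vertices, so a path
   lies entirely inside Y or has all its edges meeting X; deleting a few edges makes the
   number of edges inside Y congruent to 1 mod m and the total divisible by m. *)

Require Import Defs.
From HB Require Import structures.
From mathcomp Require Import all_boot all_order all_algebra.
From mathcomp Require Import reals.
From mathcomp Require Import boolp zify lra.

Set Implicit Arguments.
Unset Strict Implicit.
Unset Printing Implicit Defensive.

(** * Windows of words and decompositions into tight paths *)

Section Windows.
Variables (k : nat) (V : finType).
Implicit Types (w s : seq V) (e : {set V}) (X Y B : {set {set V}}).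

(** A window that runs past the end of [w] has fewer than [k] letters, hence the recurring side
    condition [i + k <= size w]. *)
Definition win w i : {set V} := [set x in take k (drop i w)].

Definition wins w a c : {set {set V}} := [set e in [seq win w i | i <- iota a c]].

Lemma winsP w a c e :
  reflect (exists2 i, a <= i < a + c & e = win w i) (e \in wins w a c).
Proof.
rewrite inE; apply: (iffP mapP) => -[i]; rewrite ?mem_iota.
  by move=> ic ->; exists i.
by move=> ic ->; exists i; rewrite ?mem_iota.
Qed.

Lemma wins_cat w a c d : wins w a (c + d) = wins w a c :|: wins w (a + c) d.
Proof. by apply/setP=> e; rewrite !inE iotaD map_cat mem_cat. Qed.

Lemma wins1 w a : wins w a 1 = [set win w a].
Proof. by apply/setP=> e; rewrite !inE /= ?inE ?orbF. Qed.

Lemma wins0 w a : wins w a 0 = set0.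
Proof. by apply/setP=> e; rewrite !inE. Qed.

Lemma win_drop w a i : win (drop a w) i = win w (a + i).
Proof. by rewrite /win drop_drop addnC. Qed.

Lemma win_cons x w i : win (x :: w) i.+1 = win w i.
Proof. by []. Qed.

Lemma wins_cons x w a c : wins (x :: w) a.+1 c = wins w a c.
Proof.
apply/setP=> e; apply/winsP/winsP => -[i ic ->].
  by exists i.-1; [lia | case: i ic => //=; lia].
by exists i.+1; [lia | ].
Qed.

Lemma win_take w n i : i + k <= n -> win (take n w) i = win w i.
Proof. by move=> h; rewrite /win !take_drop take_takel //; lia. Qed.

Lemma win_catl w s i : i + k <= size w -> win (w ++ s) i = win w i.
Proof. by move=> h; rewrite -(@win_take _ (size w)) // take_size_cat. Qed.

Lemma win_catr w s i : win (w ++ s) (size w + i) = win s i.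
Proof. by rewrite -win_drop drop_size_cat. Qed.

Lemma win_full w : size w = k -> win w 0 = [set x in w].
Proof. by move=> h; rewrite /win drop0 take_oversize // h. Qed.

Lemma card_win w i : uniq w -> i + k <= size w -> #|win w i| = k.
Proof.
move=> uw h; rewrite /win cardsE.
have u : uniq (take k (drop i w)) by rewrite take_uniq // drop_uniq.
by rewrite (card_uniqP u) size_takel // size_drop; lia.
Qed.

Lemma win_sub w i : win w i \subset [set x in w].
Proof. by apply/subsetP=> x; rewrite !inE => /mem_take /mem_drop. Qed.

Lemma mem_win x0 w i j : i <= j < i + k -> j < size w -> nth x0 w j \in win w i.
Proof.
move=> h jw; rewrite inE.
have -> : nth x0 w j = nth x0 (take k (drop i w)) (j - i).
  by rewrite nth_take ?nth_drop ?subnKC //; lia.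
have lt : j - i < minn k (size w - i) by lia.
by apply: mem_nth; rewrite size_take_min size_drop.
Qed.

Lemma winP x0 w i x : x \in win w i ->
  exists j, [/\ i <= j < i + k, j < size w & x = nth x0 w j].
Proof.
rewrite inE => /(nthP x0)[j]; rewrite size_take_min size_drop leq_min => /andP[].
change (j < k -> j < size w - i -> nth x0 (take k (drop i w)) j = x ->
  exists j0 : nat, [/\ i <= j0 < i + k, j0 < size w & x = nth x0 w j0]) => h1 h2 <-.
by exists (i + j); split; [lia..| rewrite nth_take ?nth_drop].
Qed.

Lemma win_inj w i j : 0 < k -> uniq w -> i + k <= size w -> j + k <= size w ->
  win w i = win w j -> i = j.
Proof.
move=> k0 uw.
wlog ij : i j / i < j => [hw|] hi hj E.
  by have [h|h|//] := ltngtP i j; [exact: hw | symmetry; exact: hw].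
have x0 : V by case: (w) hi => [|x ?] //=; lia.
have : nth x0 w i \in win w j by rewrite -E mem_win //; lia.
have iw : i < size w by lia.
by move=> /(winP x0)[j' [h1 h2 /eqP]]; rewrite (nth_uniq x0 iw h2 uw) => /eqP; lia.
Qed.

Lemma wins_disjoint w a b c : 0 < k -> uniq w -> a + b + c + k <= (size w).+1 ->
  [disjoint wins w a b & wins w (a + b) c].
Proof.
move=> k0 uw h; rewrite disjoint_subset; apply/subsetP=> e /winsP[i hi ->].
rewrite inE; apply/negP => /winsP[j hj] /win_inj E.
by have := E k0 uw; lia.
Qed.

Lemma card_wins w a c : 0 < k -> uniq w -> a + c + k <= (size w).+1 ->
  #|wins w a c| = c.
Proof.
move=> k0 uw h; rewrite /wins cardsE.
have u : uniq [seq win w i | i <- iota a c].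
  rewrite map_inj_in_uniq ?iota_uniq // => i j.
  by rewrite !mem_iota => hi hj /win_inj; apply=> //; lia.
by rewrite (card_uniqP u) size_map size_iota.
Qed.

Definition all_win (F : {set {set V}}) w := forall i, i + k <= size w -> win w i \in F.

Definition path_edges m B : Prop :=
  exists2 w, uniq w & size w = m + k.-1 /\ B = wins w 0 m.

(** Disjoint unions of edge sets of tight paths with [m] edges. Vertex sets are left out;
    [dec_decomposition] restores them as [cover B]. *)
Inductive dec m : {set {set V}} -> Prop :=
| dec0 : dec m set0
| decU B X : path_edges m B -> [disjoint B & X] -> dec m X -> dec m (B :|: X).

Lemma dec_disjU m X Y : dec m X -> dec m Y -> [disjoint X & Y] -> dec m (X :|: Y).
Proof.
move=> dX dY; elim: dX => [|B X' pB dBX dX' IH] d; first by rewrite set0U.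
move: d; rewrite -!setI_eq0 setIUl setU_eq0 => /andP[d1 d2].
rewrite -setUA; apply: decU => //; last by apply: IH; rewrite -setI_eq0.
by rewrite -setI_eq0 setIUr setU_eq0 setI_eq0 dBX.
Qed.

Lemma dec_bigcup (I : eqType) m (r : seq I) (F : I -> {set {set V}}) :
  uniq r -> (forall i, i \in r -> dec m (F i)) ->
  (forall i j, i \in r -> j \in r -> i != j -> [disjoint F i & F j]) ->
  dec m (\bigcup_(i <- r) F i).
Proof.
elim: r => [|i r IH] /=; first by rewrite big_nil => *; apply: dec0.
move=> /andP[ir ur] dF djF; rewrite big_cons; apply: dec_disjU.
- by apply: dF; rewrite inE eqxx.
- apply: IH => // [j jr|j j' jr jr']; first by apply: dF; rewrite inE jr orbT.
  by apply: djF; rewrite inE ?jr ?jr' orbT.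
- rewrite big_seq; elim/big_ind: _ => [|X Y h1 h2|j jr].
  + by rewrite -setI_eq0 setI0.
  + by rewrite -setI_eq0 setIUr setU_eq0 !setI_eq0 h1.
  + apply: djF; rewrite ?inE ?eqxx ?jr ?orbT //.
    by apply: contraNneq ir => ->.
Qed.

Lemma dec_dvd m X : 0 < k -> dec m X -> m %| #|X|.
Proof.
move=> k0; elim=> [|B X' [w uw [sw ->]] d _ IH]; first by rewrite cards0.
rewrite cardsU (disjoint_setI0 d) cards0 subn0 card_wins //; last by rewrite sw; lia.
by rewrite dvdn_addr.
Qed.

(** The path is cut into [q] consecutive pieces of [m] windows; neighbouring pieces overlap in
    [k - 1] vertices but share no window. *)
Lemma dec_wins m w a q : 0 < k -> uniq w -> a + q * m + k <= (size w).+1 ->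
  dec m (wins w a (q * m)).
Proof.
move=> k0 uw; elim: q a => [|q IH] a; first by rewrite mul0n wins0 => _; apply: dec0.
rewrite mulSn => h; rewrite wins_cat; apply: decU; last by apply: IH; lia.
- exists (take (m + k.-1) (drop a w)); first by rewrite take_uniq // drop_uniq.
  have h' : m + k.-1 <= size w - a by lia.
  split; first by rewrite size_takel // size_drop.
  apply/setP=> e; apply/winsP/winsP => -[i hi ->].
    exists (i - a); first by lia.
    by rewrite win_take ?win_drop; [congr win|]; lia.
  by exists (a + i); [lia | rewrite win_take ?win_drop //; lia].
- by apply: wins_disjoint => //; lia.
Qed.

End Windows.

(** * Degrees and maximal packings *)

Section Degrees.
Variables (k : nat) (V : finType).
Implicit Types (F E L : {set {set V}}) (S e : {set V}) (w : seq V).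

Definition ngb F S : {set V} := [set v | v |: S \in F].

Lemma card_ngb F S : 0 < k -> uniform k F -> #|S| = k.-1 ->
  #|ngb F S| = degree F S.
Proof.
move=> k0 uF cS; rewrite /degree.
have nS v : v \in ngb F S -> v \notin S.
  by rewrite inE => /uF; rewrite cardsU1 cS; case: (v \in S) => //=; lia.
have <- : [set v |: S | v in ngb F S] = [set e in F | S \subset e].
  apply/setP=> e; apply/imsetP/idP => [[v vF ->]|].
    by move: vF; rewrite !inE => ->; rewrite subsetUr.
  rewrite inE => /andP[eF Se].
  have /eqP/cards1P[v ev] : #|e :\: S| = 1.
    by rewrite cardsD (setIidPr Se) (uF _ eF) cS; lia.
  have eE : e = v |: S by rewrite -(setID e S) (setIidPr Se) ev setUC.
  by exists v; rewrite ?inE -?eE.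
rewrite card_in_imset // => v v' /nS vS /nS v'S /setP/(_ v).
by rewrite !inE eqxx (negPf vS) !orbF => /esym/eqP.
Qed.

(** While some (k-1)-set has positive degree below [d], delete all edges through it and let [alpha]
    record that set. A set is treated at most once, since its degree is zero from then on; so each
    fibre of [alpha] has at most [d] elements. *)
Lemma peel d F : uniform k F ->
  exists F' (alpha : {set V} -> {set V}),
  [/\ F' \subset F,
      forall S, #|S| = k.-1 -> 0 < degree F' S -> d <= degree F' S,
      forall e, e \in F :\: F' -> alpha e \subset e /\ #|alpha e| = k.-1 &
      forall S, #|[set e in F :\: F' | alpha e == S]| <= d].
Proof.
elim: {F}_.+1 {-2}F (ltnSn #|F|) => // c IH F cF uF.
have [/existsP[S /and3P[/eqP cS S0 Sd]]|] :=
  boolP [exists S : {set V}, [&& #|S| == k.-1, 0 < degree F S & degree F S < d]]; last first.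
  rewrite negb_exists => /forallP H; exists F, id; split=> //.
  - by move=> S cS S0; have := H S; rewrite cS eqxx S0 /= -leqNgt.
  - by move=> e; rewrite setDv inE.
  - by move=> S; rewrite setDv (_ : [set _ in _ | _] = set0) ?cards0 //;
      apply/setP=> e; rewrite !inE.
pose st := [set e in F | S \subset e].
have stF : st \subset F by apply/subsetP=> e; rewrite inE => /andP[].
have st0 : 0 < #|st| by [].
have [||F' [al [F'F dF' alF fib]]] := IH (F :\: st).
- by rewrite cardsD (setIidPr stF); have := subset_leq_card stF; lia.
- by move=> e /setDP[/uF].
exists F', (fun e => if e \in st then S else al e); split=> //.
- by apply: (subset_trans F'F); rewrite subsetDl.
- move=> e /setDP[eF eF']; have [|est] := boolP (e \in st); first by rewrite inE => /andP[_ ->].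
  by apply: alF; rewrite !in_setD est eF eF'.
move=> S0'; have [->|neS] := eqVneq S0' S.
  apply: leq_trans (ltnW Sd); apply: subset_leq_card; apply/subsetP=> e.
  rewrite inE => /andP[/setDP[eF eF']]; have [//|est] := boolP (e \in st).
  move=> /eqP aS; have := alF e; rewrite !in_setD est eF eF' aS => /(_ isT)[Se _].
  by move: est; rewrite inE eF Se.
apply: leq_trans (fib S0'); apply: subset_leq_card; apply/subsetP=> e.
rewrite !in_set => /andP[/andP[-> eF]].
have [est|est] := ifPn; first by rewrite eq_sym (negPf neS).
by move=> ->; rewrite eF.
Qed.

Definition tail w : {set V} := [set x in drop (size w - k.-1) w].

(** The last window is an edge, so its [k] letters are distinct, although [w] may repeat letters
    elsewhere. *)
Lemma card_tail F w : 0 < k -> uniform k F -> all_win k F w -> k <= size w ->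
  #|tail w| = k.-1.
Proof.
move=> k0 uF aw kw.
have : win k w (size w - k) \in F by apply: aw; lia.
have sz : size (drop (size w - k) w) = k by rewrite size_drop; lia.
move/uF; rewrite /win take_oversize ?sz // cardsE => h.
have u : uniq (drop (size w - k) w) by apply/card_uniqP; rewrite h sz.
have -> : tail w = [set x in drop 1 (drop (size w - k) w)].
  by rewrite /tail drop_drop; have -> : size w - k.-1 = 1 + (size w - k) by lia.
by rewrite cardsE (card_uniqP (drop_uniq 1 u)) size_drop -subn1; congr (_ - 1).
Qed.

Lemma all_win_rcons F w v : 0 < k -> k.-1 <= size w -> all_win k F w ->
  v \in ngb F (tail w) -> all_win k F (rcons w v).
Proof.
move=> k0 kw aw vF i; rewrite size_rcons -cats1 => hi.
have [h|h] := leqP (i + k) (size w); first by rewrite win_catl //; apply: aw.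
move: vF; rewrite inE; congr (_ \in F).
have -> : i = size w - k.-1 by lia.
rewrite /win /tail drop_cat; case: ltnP => h2.
  rewrite take_oversize; last by rewrite size_cat size_drop /=; lia.
  by apply/setP=> x; rewrite !inE mem_cat inE orbC.
have -> : k = 1 by lia.
by rewrite subn0 subnn drop_size /=; apply/setP=> x; rewrite !inE orbF.
Qed.

Lemma tail_degree_gt0 F w : 0 < k -> k <= size w -> all_win k F w -> 0 < degree F (tail w).
Proof.
move=> k0 kw aw; apply/card_gt0P; exists (win k w (size w - k)).
rewrite inE aw ?subnK //=; apply/subsetP=> x; rewrite !inE take_oversize; last first.
  by rewrite size_drop; lia.
have -> : size w - k.-1 = 1 + (size w - k) by lia.
by rewrite -drop_drop => /mem_drop.
Qed.

(** Greedy extension: a path with fewer than [d] vertices cannot contain all of the at least [d]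
    neighbours of its tail. *)
Lemma long_path F d : 0 < k -> uniform k F -> F != set0 ->
  (forall S, #|S| = k.-1 -> 0 < degree F S -> d <= degree F S) ->
  exists w, [/\ uniq w, size w = d & all_win k F w] \/ d < k.
Proof.
move=> k0 uF /set0Pn[e eF] dF.
have [|kd] := ltnP d k; first by exists [::]; right.
suff H c : k + c <= d -> exists w, [/\ uniq w, size w = k + c & all_win k F w].
  by have := H (d - k); rewrite subnKC // => /(_ (leqnn _))[w ?]; exists w; left.
elim: c => [|c IH] hc.
  exists (enum e); have sz : size (enum e) = k by rewrite -cardE; exact: uF.
  split; [exact: enum_uniq | by rewrite sz addn0 |].
  rewrite /all_win sz => i hi; have -> : i = 0 by lia.
  by rewrite win_full // (_ : [set x in _] = e) //; apply/setP=> x; rewrite inE mem_enum.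
have [|w [uw sw aw]] := IH; first by lia.
have kw : k <= size w by rewrite sw leq_addr.
have /set0Pn[v] : ngb F (tail w) :\: [set x in w] != set0.
  rewrite -card_gt0 cardsD.
  have le : #|ngb F (tail w) :&: [set x in w]| <= size w.
    apply: leq_trans (subset_leq_card (subsetIr _ _)) _.
    by rewrite cardsE card_size.
  have cT := card_tail k0 uF aw kw.
  have := dF _ cT (tail_degree_gt0 k0 kw aw); rewrite -card_ngb //; move: le; rewrite sw; lia.
rewrite !inE => /andP[vw vF]; exists (rcons w v); split.
- by rewrite rcons_uniq vw.
- by rewrite size_rcons sw addnS.
- by apply: all_win_rcons; rewrite ?inE //; lia.
Qed.

Lemma packing m E : 0 < m -> 0 < k ->
  exists L, [/\ L \subset E, dec k m (E :\: L) &
    forall B, path_edges k m B -> ~ B \subset L].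
Proof.
move=> m0 k0; elim: {E}_.+1 {-2}E (ltnSn #|E|) => // c IH E cE.
have [[B pB BE]|nB] := pselect (exists2 B, path_edges k m B & B \subset E); last first.
  by exists E; split=> // [|B pB BE]; [rewrite setDv; apply: dec0 | apply: nB; exists B].
have cB : #|B| = m by have [w uw [sw ->]] := pB; rewrite card_wins // sw; lia.
have [|L [LE dL nL]] := IH (E :\: B).
  by rewrite cardsD (setIidPr BE) cB; have := subset_leq_card BE; lia.
have LB : [disjoint L & B].
  by rewrite disjoints_subset; apply: subset_trans LE _; rewrite setDE subsetIr.
exists L; split=> //; first by apply: subset_trans LE _; rewrite subsetDl.
have -> : E :\: L = B :|: (E :\: B :\: L).
  apply/setP=> e; rewrite !inE; have [eB|_] := boolP (e \in B); last by [].
  by rewrite (subsetP BE) // andbT (disjointFl LB).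
apply: decU => //; rewrite -setI_eq0; apply/eqP/setP=> e; rewrite !inE.
by case: (e \in B); rewrite //= ?andbF.
Qed.

(** [m + k.-1] is the number of vertices of the path. If peeling with this bound left some edges,
    [long_path] would find one more path, against the maximality of the packing; so every leftover
    edge is assigned to a (k-1)-set. *)
Lemma sparse_leftover m E : 0 < m -> 0 < k -> uniform k E ->
  exists L (alpha : {set V} -> {set V}), [/\ L \subset E, dec k m (E :\: L),
    forall e, e \in L -> alpha e \subset e /\ #|alpha e| = k.-1 &
    forall S, #|[set e in L | alpha e == S]| <= m + k.-1].
Proof.
move=> m0 k0 uE; have [L [LE dL nL]] := packing E m0 k0.
have uL : uniform k L by move=> e /(subsetP LE)/uE.
have [F [al [FL dF alF fib]]] := peel (m + k.-1) uL.
have F0 : F = set0.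
  apply/eqP; apply: contraT => nF.
  have uF : uniform k F by move=> e /(subsetP FL)/uL.
  have [w [[uw sw aw]|]] := long_path k0 uF nF dF; last by lia.
  case: (nL (wins k w 0 m)); first by exists w.
  apply: subset_trans FL; apply/subsetP=> e /winsP[i hi ->]; apply: aw.
  by rewrite sw; lia.
rewrite F0 setD0 in alF fib.
by exists L, al.
Qed.

End Degrees.

(** * Independent transversals *)

Lemma card_bigcup_le (I T : finType) (Pr : pred I) (F : I -> {set T}) :
  #|\bigcup_(i | Pr i) F i| <= \sum_(i | Pr i) #|F i|.
Proof.
apply: (big_ind2 (fun (A : {set T}) n => #|A| <= n)) => [|A a B b hA hB|//].
  by rewrite cards0.
by apply: leq_trans (leq_card_setU _ _) _; apply: leq_add.
Qed.

Section Transversal.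
Variables (P C : finType) (X : P -> {set C}) (cf : P -> C -> P -> C -> bool).
Variables (s D : nat).
Hypothesis cfC : forall p x q y, cf p x q y = cf q y p x.
Hypothesis Xs : forall p, s <= #|X p|.
Hypothesis cfD : forall p x, x \in X p ->
  \sum_(q | q != p) #|[set y in X q | cf p x q y]| <= D.
Hypotheses (s0 : 0 < s) (sD : 4 * D <= s).
Implicit Types (I : {set P}) (g : {ffun P -> option C}).

(** Partial choices with domain exactly [I], encoded as total functions with value [None] outside
    [I]. *)
Definition transversals I : {set {ffun P -> option C}} :=
  [set g : {ffun P -> option C} | [forall p, if g p is Some x then (p \in I) && (x \in X p) else p \notin I]
        && [forall p, forall q, (p != q) ==>
             (if g p is Some x then if g q is Some y then ~~ cf p x q y else true else true)]].

Lemma transversalsP I g : reflect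
  ((forall p, if g p is Some x then p \in I /\ x \in X p else p \notin I) /\
   forall p q x y, p != q -> g p = Some x -> g q = Some y -> ~~ cf p x q y)
  (g \in transversals I).
Proof.
rewrite inE; apply: (iffP andP) => -[h1 h2]; split.
- by move=> p; have := forallP h1 p; case: (g p) => // x /andP.
- move=> p q x y pq gp gq; have := forallP (forallP h2 p) q.
  by rewrite pq gp gq.
- by apply/forallP=> p; have := h1 p; case: (g p) => // x /andP.
- apply/forallP=> p; apply/forallP=> q; apply/implyP=> pq.
  case gp: (g p) => [x|] //; case gq: (g q) => [y|] //; exact: (h2 p q).
Qed.

Lemma card_transversals_fix I q y : q \in I ->
  #|[set g in transversals I | g q == Some y]| <= #|transversals (I :\ q)|.
Proof.
move=> qI; pose del g : {ffun P -> option C} := [ffun p => if p == q then None else g p].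
rewrite -(@card_in_imset _ _ del); last first.
  move=> g g'; rewrite !inE => /andP[_ /eqP gq] /andP[_ /eqP g'q] /ffunP E.
  apply/ffunP=> p; have := E p; rewrite !ffunE; case: eqP => // -> _.
  by rewrite gq g'q.
apply: subset_leq_card; apply/subsetP=> _ /imsetP[g + ->].
rewrite inE => /andP[/transversalsP[h1 h2] _]; apply/transversalsP; split.
- move=> p; rewrite ffunE !inE; case: eqP => // _; exact: h1.
- move=> p p' x x' pp'; rewrite !ffunE; case: eqP => // _; case: eqP => // _.
  exact: h2.
Qed.

Lemma sum_card_fibers (A B : finType) (E : {set A}) (F : {set B}) (f : A -> option B) :
  \sum_(x in F) #|[set a in E | f a == Some x]| <= #|E|.
Proof.
under eq_bigr do rewrite -sum1dep_card big_mkcondr.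
rewrite exchange_big /= -sum1_card; apply: leq_sum => a _.
case fa: (f a) => [x|]; last by rewrite big1.
under eq_bigr do rewrite -(inj_eq (@Some_inj _)) eq_sym.
rewrite -big_mkcondr sum1dep_card.
apply: leq_trans (_ : #|[set x]| <= 1); last by rewrite cards1.
by apply: subset_leq_card; apply/subsetP=> z; rewrite !inE => /andP[_ /eqP[->]].
Qed.

(* A transversal of [I] that does not extend by [x] contains some [y] in conflict
   with [x], and inductively at most a [2 / s] share of the transversals of [I]
   contain any given [y]. *)
Lemma transversals_step I p : p \notin I ->
  s * #|transversals I| <= 2 * #|transversals (p |: I)|.
Proof.
move: {2}_.+1 (ltnSn #|I|) => c; elim: c => // c IH in I p *.
move=> cI pI; set N := #|transversals I|.
(* Of the [N] transversals of [I], those without an element in conflict with [x] extend by [x]; the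
   double sum bounds the others. *)
have good : forall x, x \in X p ->
  N <= #|[set g in transversals (p |: I) | g p == Some x]| +
       \sum_(q | q != p) \sum_(y in [set y in X q | cf p x q y])
          #|[set g in transversals I | g q == Some y]|.
  move=> x xX.
  pose bad := \bigcup_(q | q != p) \bigcup_(y in [set y in X q | cf p x q y])
          [set g in transversals I | g q == Some y].
  apply: leq_trans (_ : #|transversals I :\: bad| + #|bad| <= _).
    by rewrite /N -(cardsID bad (transversals I)) addnC leq_add2l subset_leq_card // subsetIr.
  apply: leq_add.
    pose ext g : {ffun P -> option C} := [ffun q => if q == p then Some x else g q].
    rewrite -(@card_in_imset _ _ ext); last first.
      move=> g g' /setDP[/transversalsP[h _] _] /setDP[/transversalsP[h' _] _].
      move=> /ffunP E; apply/ffunP=> q; have := E q; rewrite !ffunE; case: eqP => // -> _.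
      have := h p; case: (g p) => [? []|_]; first by rewrite (negPf pI).
      by have := h' p; case: (g' p) => [? []|_]; first by rewrite (negPf pI).
    apply: subset_leq_card; apply/subsetP=> _ /imsetP[g + ->].
    move=> /setDP[gT gb]; have /transversalsP[h1 h2] := gT.
    have nb q y : q != p -> g q = Some y -> ~~ cf p x q y.
      move=> qp gq; apply: contra gb => cc; apply/bigcupP; exists q => //.
      apply/bigcupP; exists y; last by rewrite inE gT gq eqxx.
      by have := h1 q; rewrite gq inE cc => -[_ ->].
    rewrite inE ffunE !eqxx andbT; apply/transversalsP; split.
      move=> q; rewrite ffunE !inE; have [->|qp] := eqVneq q p; first by split.
      by have := h1 q; case: (g q).
    move=> q r y z qr; rewrite !ffunE.
    case: (eqVneq q p) => [qp|qp]; case: (eqVneq r p) => [rp|rp].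
    - by rewrite qp rp eqxx in qr.
    - by case=> <-; rewrite qp; exact: nb.
    - by move=> gq [<-]; rewrite rp cfC; exact: nb.
    - exact: h2.
  apply: leq_trans (card_bigcup_le _ _) _.
  by apply: leq_sum => q _; apply: card_bigcup_le.
(* By induction for [I :\ q], prescribing [y] at [q] leaves at most [2 * N / s] transversals. *)
have fixb q y : s * #|[set g in transversals I | g q == Some y]| <= 2 * N.
  have [qI|qI] := boolP (q \in I); last first.
    rewrite (_ : [set _ in _ | _] = set0) ?cards0 ?muln0 //.
    apply/setP=> g; rewrite [RHS]inE; apply/negP; rewrite in_set.
    move=> /andP[/transversalsP[h _] /eqP gq].
    by have := h q; rewrite gq (negPf qI) => -[].
  have := IH (I :\ q) q; rewrite setD11 setD1K // => /(_ _ isT) h.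
  apply: leq_trans (h _); last by have := cardsD1 q I; rewrite qI; lia.
  by rewrite leq_mul2l card_transversals_fix ?orbT.
(* Sum over all [x] in [X p]. Because [4 * D <= s], the conflict term is at most half of the left
   side, as [h] shows below. *)
have total : s * (#|X p| * N) <= s * #|transversals (p |: I)| + #|X p| * (D * (2 * N)).
  apply: leq_trans (_ : \sum_(x in X p) (s * #|[set g in transversals (p |: I) | g p == Some x]| +
      D * (2 * N)) <= _); last first.
    rewrite big_split /= sum_nat_const leq_add2r -big_distrr leq_mul2l.
    by rewrite (sum_card_fibers _ _ (fun g : {ffun P -> option C} => g p)) orbT.
  rewrite mulnCA -sum_nat_const; apply: leq_sum => x xX.
  apply: leq_trans (_ : s * (_ + _) <= _); first by rewrite leq_mul2l; apply/orP; right; exact: good xX.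
  rewrite mulnDr leq_add2l big_distrr /=.
  apply: leq_trans (_ : (\sum_(q | q != p) #|[set y in X q | cf p x q y]|) * (2 * N) <= _); last first.
    by rewrite leq_mul2r cfD ?orbT.
  rewrite big_distrl /=; apply: leq_sum => q _.
  rewrite big_distrr /= -sum_nat_const; apply: leq_sum => y _; exact: fixb.
have h : #|X p| * (D * (2 * N)) * 2 <= s * (#|X p| * N).
  have -> : #|X p| * (D * (2 * N)) * 2 = (4 * D) * (#|X p| * N) by nia.
  by rewrite leq_mul2r sD orbT.
have : s * (#|X p| * N) <= s * (2 * #|transversals (p |: I)|) by lia.
rewrite leq_pmul2l //; apply: leq_trans; by rewrite leq_mul2r Xs orbT.
Qed.

Lemma transversal_exists : exists f : P -> C,
  (forall p, f p \in X p) /\ forall p q, p != q -> ~~ cf p (f p) q (f q).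
Proof.
have H : 0 < #|transversals [set: P]|.
  suff h c (I : {set P}) : #|I| = c -> 0 < #|transversals I| by exact: h.
  elim: c I => [|c IH] I.
    move/cards0_eq=> ->; apply/card_gt0P; exists [ffun => None].
    by apply/transversalsP; split=> [p|p q x y _]; rewrite ffunE ?inE.
  move=> cI; have /card_gt0P[p pI] : 0 < #|I| by rewrite cI.
  have := @transversals_step (I :\ p) p; rewrite setD11 setD1K // => /(_ isT).
  have : 0 < #|transversals (I :\ p)| by apply: IH; have := cardsD1 p I; rewrite pI; lia.
  by case: #|transversals I| => //; nia.
have /card_gt0P[g /transversalsP[h1 h2]] := H.
have ex p : {x | g p = Some x} by have := h1 p; case: (g p) => [x|]; [exists x | rewrite inE].
exists (fun p => sval (ex p)); split=> [p|p q pq].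
  by case: (ex p) => x gp /=; have := h1 p; rewrite gp => -[].
by apply: h2 pq _ _; [case: (ex p)| case: (ex q)].
Qed.

End Transversal.

(** * Absorption *)

Lemma disjoint_setP (T : finType) (B C : {set T}) :
  reflect (forall x, x \in B -> x \notin C) [disjoint B & C].
Proof.
apply: (iffP idP) => [d x xB|h]; first by rewrite (disjointFr d).
by rewrite disjoint_subset; apply/subsetP=> x /h.
Qed.

(** * A tree on the vertex sets of a given size *)

Section Descent.
Variable V : finType.
Implicit Types (S T : {set V}) (a b v : V).

Definition rk v : nat := enum_rank v.
Definition rank S := \sum_(v in S) rk v.

Lemma rk_inj : injective rk.
Proof. by move=> v w /val_inj /enum_rank_inj. Qed.

(* [nx] replaces a vertex by its predecessor in the enumeration of [V] and fixes only the
   initial segments, so that its iterates form a tree on the sets of a given size. *)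
Definition swap_pair S (ab : V * V) :=
  [&& ab.1 \in S, ab.2 \notin S & rk ab.1 == (rk ab.2).+1].

Definition nx S := if [pick ab | swap_pair S ab] is Some ab
  then ab.2 |: (S :\ ab.1) else S.

(** A fixed point is covered by [b = a], so the construction of gadgets needs no special case for
    the root. *)
Lemma nxP S : S != set0 ->
  exists a b, [/\ a \in S, b \notin S :\ a & nx S = b |: (S :\ a)].
Proof.
move=> /set0Pn[a aS]; rewrite /nx; case: pickP => [[a' b'] /and3P[/= h1 h2 _]|_].
  by exists a', b'; rewrite inE (negPf h2) andbF.
by exists a, a; rewrite !inE eqxx setD1K.
Qed.

Lemma card_nx S : #|nx S| = #|S|.
Proof.
have [->|/nxP[a [b [aS bS ->]]]] := eqVneq S set0.
  by rewrite /nx; case: pickP => // -[a b]; rewrite /swap_pair inE.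
by rewrite cardsU1 bS (cardsD1 a S) aS.
Qed.

Lemma rank_nx S : nx S != S -> rank (nx S) < rank S.
Proof.
rewrite /nx; case: pickP => [[a b] /and3P[/= aS bS /eqP ab] _|_]; last by rewrite eqxx.
rewrite /rank big_setU1 /=; last by rewrite !inE (negPf bS) andbF.
by rewrite (big_setD1 a aS) /= ab ltnS.
Qed.

(** A set that admits no swap contains the predecessor of each of its elements; descend from [a] to
    [b] one rank at a time. *)
Lemma nx_fixed_closed S a b : nx S = S -> a \in S -> rk b <= rk a -> b \in S.
Proof.
move=> nS aS; have step a' b' : a' \in S -> rk a' = (rk b').+1 -> b' \in S.
  move=> aS' ab; apply: contraT => bS; move: nS; rewrite /nx.
  case: pickP => [[x y] /and3P[/= xS yS _] /setP/(_ y)|/(_ (a', b'))].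
    by rewrite !inE eqxx (negPf yS).
  by rewrite /swap_pair /= aS' bS ab eqxx.
move: {2}(rk a - rk b) (erefl (rk a - rk b)) => c; elim: c b => [|c IH] b.
  by move=> h1 h2; have /rk_inj-> : rk b = rk a by lia.
move=> h1 h2; have lt : (rk b).+1 < #|V|.
  by apply: leq_ltn_trans (ltn_ord (enum_rank a)); rewrite -/(rk a); lia.
have e : rk (enum_val (Ordinal lt)) = (rk b).+1 by rewrite /rk enum_valK.
by apply: (step _ _ _ e); apply: IH; lia.
Qed.

(** Fixed points are initial segments of the enumeration, hence determined by their size. *)
Lemma nx_fixed_unique S T : nx S = S -> nx T = T -> #|S| = #|T| -> S = T.
Proof.
move=> fS fT cST; apply/eqP; rewrite eqEcard cST leqnn andbT.
apply/subsetP=> a aS; apply: contraT => aT.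
have TS : T \subset S.
  apply/subsetP=> b bT; apply: (nx_fixed_closed fS aS).
  by apply: contraNT aT; rewrite -ltnNge => /ltnW; exact: nx_fixed_closed.
have /eqP E : T == S by rewrite eqEcard TS cST leqnn.
by rewrite E aS in aT.
Qed.

(** [S] is [T] itself or arises from [T] by moving one vertex [b] to its successor. *)
Lemma card_nx_fiber T : #|[set S | nx S == T]| <= #|T|.+1.
Proof.
pose succ b := if [pick a | rk a == (rk b).+1] is Some a then a else b.
pose B := [set succ b |: (T :\ b) | b in T].
apply: leq_trans (_ : #|T |: B| <= _); last first.
  rewrite cardsU1 -add1n leq_add //; first by case: (_ \in _).
  exact: leq_imset_card.
apply: subset_leq_card; apply/subsetP=> S; rewrite !inE /nx.
case: pickP => [[a b] /and3P[/= aS bS /eqP ab] /eqP ET|_ ->//].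
apply/orP; right; apply/imsetP; exists b; first by rewrite -ET !inE eqxx.
have -> : succ b = a.
  rewrite /succ; case: pickP => [c /eqP|/(_ a)]; last by rewrite ab eqxx.
  by rewrite -ab => /rk_inj.
rewrite -ET; apply/setP=> x; rewrite !inE.
have [->|xa] := eqVneq x a; first by rewrite aS.
by have [->|] := eqVneq x b; rewrite ?(negPf bS).
Qed.

End Descent.

(** * Gadgets and the passing of tokens *)

Section Gadget.
Variables (k m : nat) (V : finType).
Implicit Types (S T x : {set V}) (F X : {set {set V}}).

Definition usable F S x := [&& #|x| == k, S \subset x & x \notin F].

(* The reserved edges [K] can absorb [m] further edges containing [S], and [A] can trade
   one such edge for [g], which contains [T]; [F] lists the k-sets for which this may fail. *)
Definition gadget S T F (K A : {set {set V}}) (g : {set V}) : Prop :=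
  [/\ [disjoint K & A], K \subset F, A \subset F, g \in A & T \subset g] /\
  [/\ dec k m K, dec k m A,
      forall X, #|X| = m -> (forall x, x \in X -> usable F S x) -> dec k m (K :|: X) &
      forall x, usable F S x -> dec k m (x |: (A :\ g))].

End Gadget.

Section Absorption.
Variables (k m t R : nat) (V : finType).
Variables (K A fp : {set V} -> 'I_R -> {set {set V}}) (g : {set V} -> 'I_R -> {set V}).
Hypotheses (k0 : 0 < k) (m0 : 0 < m).
Implicit Types (S y x : {set V}) (X Y Z D : {set {set V}}) (r : 'I_R) (J Q : {set 'I_R}).

Definition is_gadget S r := gadget k m S (nx S) (fp S r) (K S r) (A S r) (g S r).

Hypothesis gadgets : forall S r, #|S| = k.-1 -> is_gadget S r.
Hypothesis gadgets_card : forall S r x, #|S| = k.-1 -> x \in fp S r -> #|x| = k.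
Hypothesis fp_disjoint : forall S r S' r', #|S| = k.-1 -> #|S'| = k.-1 ->
  (S, r) != (S', r') -> [disjoint fp S r & fp S' r'].

Definition gad S r := K S r :|: A S r.

Lemma gad_sub_fp S r : #|S| = k.-1 -> gad S r \subset fp S r.
Proof. by case/(gadgets r) => -[_ h1 h2 _ _] _; rewrite subUset h1. Qed.

Lemma gad_disjoint S r S' r' : #|S| = k.-1 -> #|S'| = k.-1 ->
  (S, r) != (S', r') -> [disjoint gad S r & gad S' r'].
Proof.
move=> c c' ne; apply: disjointWl (gad_sub_fp r c) _; apply: disjointWr (gad_sub_fp r' c') _.
exact: fp_disjoint.
Qed.

Lemma dec_gad S r : #|S| = k.-1 -> dec k m (gad S r).
Proof. by case/(gadgets r) => -[d _ _ _ _] [dK dA _ _]; apply: dec_disjU. Qed.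

Lemma dec_bigcup_in (I : finType) (J : {set I}) (F : I -> {set {set V}}) :
  (forall i, i \in J -> dec k m (F i)) ->
  (forall i j, i \in J -> j \in J -> i != j -> [disjoint F i & F j]) ->
  dec k m (\bigcup_(i in J) F i).
Proof.
move=> h1 h2; rewrite -big_enum /=; apply: dec_bigcup; first exact: enum_uniq.
  by move=> i; rewrite mem_enum; exact: h1.
by move=> i j; rewrite !mem_enum; exact: h2.
Qed.

Lemma dec_gads S J : #|S| = k.-1 -> dec k m (\bigcup_(r in J) gad S r).
Proof.
move=> cS; apply: dec_bigcup_in => [r _|r r' _ _ rr']; first exact: dec_gad.
by apply: gad_disjoint => //; apply: contra rr' => /eqP[->].
Qed.

Lemma gads_fp S J r x : #|S| = k.-1 -> r \notin J -> x \in \bigcup_(r in J) gad S r ->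
  x \notin fp S r.
Proof.
move=> cS rJ /bigcupP[r' rJ' /(subsetP (gad_sub_fp r' cS))]; apply/disjoint_setP.
by apply: fp_disjoint => //; apply: contraNneq rJ => -[<-].
Qed.

(** As long as [m] tokens remain, one gadget absorbs [m] of them through its [K], while its [A] is
    decomposed alone. Each of the last [#|Y| %% m] tokens is traded through the [A] of a further
    gadget, whose edge [g S r] becomes a token in its place. Gadgets left over decompose by
    themselves. *)
Lemma absorb_at S Y J : #|S| = k.-1 ->
  (forall y r, y \in Y -> r \in J -> usable k (fp S r) S y) -> #|Y| <= #|J| ->
  exists Q D, [/\ Q \subset J, #|Q| = #|Y| %% m, dec k m D,
    [disjoint D & [set g S r | r in Q]] &
    D :|: [set g S r | r in Q] = Y :|: \bigcup_(r in J) gad S r].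
Proof.
move=> cS; move: {2}_.+1 (ltnSn #|Y|) => c; elim: c => // c IH in Y J *.
move=> cY uY YJ; have [Y0|[y yY]] := set_0Vmem Y.
  exists set0, (\bigcup_(r in J) gad S r); rewrite sub0set Y0 !cards0 mod0n set0U.
  rewrite imset0 setU0 disjoint_sym; split=> //; first exact: dec_gads.
  by apply/disjoint_setP => x; rewrite inE.
have [r rJ] : exists r, r \in J.
  by apply/card_gt0P; apply: leq_trans YJ; apply/card_gt0P; exists y.
have [[dKA Kf Af gA _] [dK dA dKX dAx]] := gadgets r cS.
have gadJ : \bigcup_(r in J) gad S r = gad S r :|: \bigcup_(i in J :\ r) gad S i.
  by rewrite (big_setD1 r rJ).
(* What the recursive call handles avoids the footprint of gadget [r], so it can be joined
   disjointly with the use made of that gadget. *)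
have restP Y' Q D : Y' \subset Y -> Q \subset J :\ r ->
    D :|: [set g S r | r in Q] = Y' :|: \bigcup_(i in J :\ r) gad S i ->
    (forall x, x \in D :|: [set g S r | r in Q] -> x \notin fp S r).
  move=> Y'Y QJ -> x; rewrite inE => /orP[/(subsetP Y'Y) xY|].
    by have /and3P[] := uY _ _ xY rJ.
  by move=> xG; apply: gads_fp xG; rewrite ?setD11.
have gK x : x \in K S r -> x \in fp S r by apply/subsetP.
have gAf x : x \in A S r -> x \in fp S r by apply/subsetP.
have [mY|Ym] := leqP m #|Y|.
  pose X := [set x in take m (enum Y)].
  have XY : X \subset Y by apply/subsetP=> x; rewrite inE => /mem_take; rewrite mem_enum.
  have cX : #|X| = m.
    by rewrite cardsE (card_uniqP (take_uniq _ (enum_uniq _))) size_takel // -cardE.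
  have cYX : #|Y :\: X| = #|Y| - m by rewrite cardsD (setIidPr XY) cX.
  have [||| Q [D [QJ cQ dD djD eD]]] := IH (Y :\: X) (J :\ r).
  - by rewrite cYX; lia.
  - by move=> x r' /setDP[xY _] /setD1P[_]; exact: uY.
  - by move: YJ m0; rewrite (cardsD1 r J) rJ cYX add1n; move: #|Y| #|J :\ r|; lia.
  have rest := restP _ _ _ (subsetDl Y X) QJ eD.
  exists Q, ((K S r :|: X) :|: (A S r :|: D)); split.
  - by apply: subset_trans QJ (subsetDl _ _).
  - by rewrite cQ cYX -{2}(subnK mY) modnDr.
  - apply: dec_disjU.
    + by apply: dKX => // x /(subsetP XY) xY; exact: uY.
    + apply: dec_disjU => //; apply/disjoint_setP => x /gAf xf.
      by apply: contraL xf => xD; apply: rest; rewrite inE xD.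
    + apply/disjoint_setP => x; rewrite !in_setU => /orP[xK|xX].
        rewrite (disjointFr dKA xK) /=; apply: contraL (gK _ xK) => xD.
        by apply: rest; rewrite inE xD.
      rewrite negb_or; apply/andP; split.
        have /and3P[_ _] := uY _ _ (subsetP XY _ xX) rJ.
        by apply: contra; exact: gAf.
      have : x \notin \bigcup_(i in J :\ r) gad S i.
        apply/negP => /bigcupP[r' /setD1P[_ r'J] /(subsetP (gad_sub_fp r' cS))].
        by have /and3P[_ _ /negPf->] := uY _ _ (subsetP XY _ xX) r'J.
      have/setP/(_ x) := eD; rewrite [in RHS]in_setU in_setD xX /= => <-.
      by rewrite in_setU negb_or => /andP[].
  - apply/disjoint_setP => x; rewrite !in_setU => /orP[xKX|/orP[xA|xD]].
    + apply/negP => xg; have xr := rest x; rewrite inE xg orbT in xr.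
      case/orP: xKX => [/gK xf|xX]; first by move: (xr isT); rewrite xf.
      case/imsetP: xg => r' r'Q ex; have r'J : r' \in J by have /setD1P[] := subsetP QJ _ r'Q.
      have /and3P[_ _] := uY _ _ (subsetP XY _ xX) r'J.
      have [[_ _ Af' gA' _] _] := gadgets r' cS.
      by rewrite ex (subsetP Af').
    + apply/negP => xg; have := rest x; rewrite inE xg orbT gAf // => /(_ isT).
      by [].
    + by rewrite (disjointFr djD).
  - rewrite -!setUA eD gadJ; apply/setP=> x; rewrite !in_setU in_setD.
    have := subsetP XY x; case: (x \in X) => [/(_ isT)->|_]; rewrite ?orbT //=.
    by case: (x \in K S r); case: (x \in A S r); case: (x \in Y); rewrite ?orbT.
have [||| Q [D [QJ cQ dD djD eD]]] := IH (Y :\ y) (J :\ r).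
- by have := cardsD1 y Y; rewrite yY; lia.
- by move=> x r' /setD1P[_ xY] /setD1P[_]; exact: uY.
- by move: YJ; rewrite (cardsD1 r J) (cardsD1 y Y) rJ yY.
have rest := restP _ _ _ (subsetDl Y _) QJ eD.
have rQ : r \notin Q by apply/negP => /(subsetP QJ); rewrite setD11.
have yf : y \notin fp S r by have /and3P[] := uY _ _ yY rJ.
have yA : y \notin A S r by apply: contra yf; exact: gAf.
have ny : y \notin D :|: [set g S r | r in Q].
  rewrite eD !inE eqxx /=; apply/negP => /bigcupP[r' /setD1P[_ r'J] /(subsetP (gad_sub_fp r' cS))].
  by have /and3P[_ _ /negPf->] := uY _ _ yY r'J.
exists (r |: Q), ((y |: (A S r :\ g S r)) :|: (K S r :|: D)); split.
- by rewrite subUset sub1set rJ (subset_trans QJ (subsetDl _ _)).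
- have cY1 := cardsD1 y Y; rewrite yY in cY1.
  have lt : #|Y :\ y| < m by apply: leq_ltn_trans Ym; rewrite cY1 leq_addl.
  by rewrite cardsU1 rQ cQ (modn_small lt) (modn_small Ym) cY1.
- apply: dec_disjU; first by apply: dAx; exact: uY.
    apply: dec_disjU => //; apply/disjoint_setP => x /gK xf.
    by apply: contraL xf => xD; apply: rest; rewrite inE xD.
  apply/disjoint_setP => x; rewrite !inE => /orP[/eqP->|/andP[_ xA]].
    rewrite negb_or; apply/andP; split; first by apply: contra yf; exact: gK.
    by move: ny; rewrite inE negb_or => /andP[].
  rewrite (disjointFl dKA xA) /=; apply: contraL (gAf _ xA) => xD.
  by apply: rest; rewrite inE xD.
- rewrite imsetU1; apply/disjoint_setP => x; rewrite !inE => /orP[/orP[/eqP->|/andP[xg xA]]|/orP[xK|xD]].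
  + rewrite negb_or; apply/andP; split; first by apply: contraNneq yA => ->.
    by move: ny; rewrite inE negb_or => /andP[].
  + rewrite (negPf xg) /=; apply: contraL (gAf _ xA) => xQ.
    by apply: rest; rewrite inE xQ orbT.
  + rewrite negb_or; apply/andP; split.
      by apply: contraTneq xK => ->; rewrite (disjointFl dKA gA).
    apply: contraL (gK _ xK) => xQ.
    by apply: rest; rewrite inE xQ orbT.
  + rewrite negb_or (disjointFr djD xD) andbT; apply: contraL (gAf _ gA) => /eqP <-.
    by apply: rest; rewrite inE xD.
- rewrite imsetU1 gadJ; apply/setP=> x; have/setP/(_ x) := eD; rewrite !inE.
  have [->|xg] := eqVneq x (g S r); first by rewrite gA !orbT.
  have [->|xy] := eqVneq x y; first by rewrite yY.
  by rewrite /=; case: (x \in A S r); case: (x \in K S r); rewrite ?orbT //= ?orbF.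
Qed.

Hypothesis R_large : 2 * (t + m * k) <= R.

Definition tokens (alpha : {set V} -> {set V}) Y S := [set y in Y | alpha y == S].

Lemma mem_tokens alpha Y S y : (y \in tokens alpha Y S) = (y \in Y) && (alpha y == S).
Proof. by rewrite in_set. Qed.

(* Each (k-1)-set [S] is treated after all the sets [S'] with [nx S' = S], each of
   which hands over fewer than [m] tokens; the fixed point of [nx] comes last. *)
Lemma absorb Z Y (alpha : {set V} -> {set V}) :
  (forall S, S \in Z -> #|S| = k.-1 /\ nx S \in Z) ->
  (forall y, y \in Y -> [/\ #|y| = k, alpha y \in Z & alpha y \subset y]) ->
  (forall S, S \in Z -> #|tokens alpha Y S| <= t + m * #|[set S' | nx S' == S & S' \notin Z]|) ->
  (forall S r, S \in Z -> [disjoint Y & gad S r]) ->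
  m %| #|Y| ->
  dec k m (Y :|: \bigcup_(S in Z) \bigcup_(r in [set: 'I_R]) gad S r).
Proof.
move: {2}_.+1 (ltnSn #|Z|) => c; elim: c => // c IH in Z Y alpha *.
move=> cZ HZ HY Hb Hd mY; have [Z0|[S0 S0Z]] := set_0Vmem Z.
  rewrite Z0 big_set0 setU0 (_ : Y = set0); first exact: dec0.
  apply/setP=> y; rewrite inE; apply/negP => /HY[_].
  by rewrite Z0 inE.
(* No other set of [Z] may pass tokens to [S]. As [nx] lowers the rank, a set of largest rank among
   those moved by [nx] will do; if none is moved, [Z] is a single set. *)
have [S [SZ Smax Sfix]] : exists S, [/\ S \in Z,
    forall S', S' \in Z -> nx S' = S -> S' = S & nx S != S \/ Z = [set S]].
  have [S1 /andP[S1Z S1n]|allfix] := pickP [pred S | (S \in Z) && (nx S != S)]; last first.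
    have fx S' : S' \in Z -> nx S' = S'.
      by move=> S'Z; have := allfix S'; rewrite /= S'Z /= => /negbFE/eqP.
    exists S0; split=> // [S' S'Z|]; first by rewrite fx.
    right; apply/setP=> S'; rewrite in_set1; apply/idP/eqP => [S'Z|->//].
    by apply: nx_fixed_unique; rewrite ?fx // (proj1 (HZ _ _)) // (proj1 (HZ _ _)).
  have P1 : [pred S | (S \in Z) && (nx S != S)] S1 by rewrite /= S1Z.
  case: (@arg_maxnP _ S1 _ (@rank V) P1) => S /= /andP[SZ Sn] Smax.
  exists S; split=> //; last by left.
  move=> S' S'Z nS; apply/eqP; apply: contraT => ne.
  have nS' : nx S' != S' by rewrite nS eq_sym.
  by have := rank_nx nS'; have := Smax S'; rewrite S'Z nS' nS => /(_ isT); lia.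
have [cS nSZ] := HZ _ SZ.
have fib : #|[set S' | nx S' == S & S' \notin Z]| <= k.
  apply: leq_trans (_ : #|[set S' | nx S' == S]| <= _).
    by apply: subset_leq_card; apply/subsetP=> x; rewrite !inE => /andP[].
  by have := card_nx_fiber S; rewrite cS prednK.
set YS := tokens alpha Y S.
have YSY : YS \subset Y by apply/subsetP=> y; rewrite inE => /andP[].
have cYS : #|YS| <= t + m * k.
  by apply: leq_trans (Hb _ SZ) _; rewrite leq_add2l leq_mul2l fib orbT.
pose J := [set r | [forall y in YS, y \notin fp S r]].
(* Footprints at [S] are disjoint, so each token spoils at most one gadget; by [R_large] at least as
   many usable gadgets as tokens remain. *)
have cJ : #|YS| <= #|J|.
  have : #|~: J| <= #|YS|.
    apply: leq_trans (_ : #|\bigcup_(y in YS) [set r | y \in fp S r]| <= _).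
      apply: subset_leq_card; apply/subsetP=> r; rewrite !inE => /forall_inPn[y yY].
      by rewrite negbK => yf; apply/bigcupP; exists y => //; rewrite inE.
    apply: leq_trans (card_bigcup_le _ _) _; rewrite -sum1_card; apply: leq_sum => y _.
    apply/card_le1P => r; rewrite inE => yr r'; rewrite !inE.
    apply/idP/eqP => [yr'|->//]; apply/eqP; apply: contraT => rr'.
    have ne : (S, r) != (S, r') by apply: contra rr' => /eqP[->].
    by have /disjoint_setP/(_ y yr) := fp_disjoint cS cS ne; rewrite yr'.
  by have := cardsC J; rewrite card_ord; lia.
have [|Q [D [QJ cQ dD djD eD]]] := absorb_at cS _ cJ.
  move=> y r yYS; rewrite inE => /forall_inP/(_ y yYS) yf.
  move: yYS; rewrite inE => /andP[/HY[cy _ sy] /eqP aS].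
  by rewrite /usable cy eqxx yf -aS sy.
set gQ := [set g S r | r in Q] in djD eD.
have gQg x : x \in gQ -> exists2 r, x \in gad S r & nx S \subset x.
  move=> /imsetP[r _ ->]; have [[_ _ _ gA ng] _] := gadgets r cS.
  by exists r; rewrite // inE gA orbT.
have gQY x : x \in gQ -> x \notin Y.
  move=> /gQg[r xr _]; apply: contraL xr => xY.
  by apply/disjoint_setP: x xY; exact: Hd.
have cgQ : #|gQ| = #|Q|.
  rewrite card_imset // => r r' E; apply/eqP; apply: contraT => rr'.
  have := gad_disjoint (r := r) (r' := r') cS cS; rewrite xpair_eqE eqxx rr' => /(_ isT).
  move=> /disjoint_setP/(_ (g S r)); have [[_ _ _ gA _] _] := gadgets r cS.
  have [[_ _ _ gA' _] _] := gadgets r' cS.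
  by rewrite !inE gA E gA' !orbT => /(_ isT).
pose Y' := (Y :\: YS) :|: gQ.
pose alpha' y := if y \in gQ then nx S else alpha y.
have cY' : #|Y'| = #|Y| - #|YS| + #|Q|.
  rewrite cardsU cgQ cardsD (setIidPr YSY) (_ : _ :&: gQ = set0) ?cards0 ?subn0 //.
  by apply/setP=> x; rewrite !in_setI in_setD in_set0; case xQ: (x \in gQ); rewrite ?andbF // (negPf (gQY _ xQ)) andbF.
(* If [Z] consists of [S] alone, all tokens sit at [S]; their number is a multiple of [m], so
   nothing is handed over. *)
have Q0 x : x \in gQ -> nx S != S.
  case: Sfix => // ZS xQ; have : Y = YS.
    by apply/setP=> y; rewrite inE; case yY: (y \in Y) => //=; have [_ + _] := HY y yY; rewrite ZS inE => ->.
  move=> YYS; move: cQ; rewrite -YYS (eqP mY) => /eqP; rewrite cards_eq0 => /eqP Q0.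
  by move: xQ; rewrite /gQ Q0 imset0 inE.
have mY' : m %| #|Y'|.
  have le := subset_leq_card YSY.
  rewrite (_ : #|Y'| = #|Y| - #|YS| %/ m * m).
    by rewrite dvdn_subl ?dvdn_mull // (leq_trans (leq_trunc_div _ _)).
  rewrite cY' cQ; move: le (divn_eq #|YS| m).
  by move: (#|YS| %/ m * m) (#|YS| %% m) #|YS| #|Y|; clear; lia.
have decY' : dec k m (Y' :|: \bigcup_(S' in Z :\ S) \bigcup_(r in [set: 'I_R]) gad S' r).
  apply: (IH _ _ alpha') mY'.
  - by move: cZ; rewrite (cardsD1 S Z) SZ add1n ltnS.
  - move=> S' /setD1P[ne S'Z]; have [cS' nS'] := HZ _ S'Z; split=> //.
    by rewrite !inE nS' andbT; apply: contra ne => /eqP/(Smax _ S'Z) ->.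
  - move=> y; rewrite in_setU /alpha'; have [yQ _|yQ] := boolP (y \in gQ).
      have [r yr nSy] := gQg _ yQ; rewrite in_setD1 (Q0 _ yQ) nSZ.
      by rewrite (gadgets_card cS (subsetP (gad_sub_fp r cS) _ yr)).
    rewrite orbF => /setDP[yY yYS]; have [cy aZ ay] := HY _ yY; split=> //.
    by rewrite !inE aZ andbT; move: yYS; rewrite inE yY.
  - move=> S' /setD1P[ne S'Z].
    (* At most [m] new tokens reach [nx S]; the bound has room for them because [S] leaves [Z]. *)
    have le : #|tokens alpha' Y' S'| <= #|tokens alpha Y S'| + (if nx S == S' then m else 0).
      apply: leq_trans (_ : #|tokens alpha Y S' :|: (if nx S == S' then gQ else set0)| <= _).
        apply: subset_leq_card; apply/subsetP=> y; rewrite mem_tokens [y \in Y']in_setU /alpha' => /andP[].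
        have [yQ _ ->|yQ] := boolP (y \in gQ); first by rewrite in_setU yQ orbT.
        by rewrite orbF => /setDP[yY _] ay; rewrite in_setU mem_tokens yY ay.
      apply: leq_trans (leq_card_setU _ _) _; rewrite leq_add2l.
      by case: ifP; rewrite ?cards0 // cgQ cQ => _; rewrite ltnW // ltn_pmod.
    apply: leq_trans le _; apply: leq_trans (leq_add (Hb _ S'Z) (leqnn _)) _.
    rewrite -addnA leq_add2l.
    case: ifPn => [/eqP nS|_].
      rewrite -mulnSr leq_mul2l; apply/orP; right.
      rewrite (_ : _.+1 = #|S |: [set S'0 | nx S'0 == S' & S'0 \notin Z]|).
        apply: subset_leq_card; apply/subsetP=> x; rewrite !inE => /orP[/eqP->|/andP[-> xZ]].
          by rewrite nS !eqxx.
        by rewrite (negPf xZ) andbF.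
      by rewrite cardsU1 !inE SZ andbF.
    rewrite addn0 leq_mul2l; apply/orP; right.
    by apply: subset_leq_card; apply/subsetP=> x; rewrite !inE => /andP[-> /negPf->]; rewrite andbF.
  - move=> S' r' /setD1P[ne S'Z]; have [cS' _] := HZ _ S'Z.
    apply/disjoint_setP => x; rewrite in_setU => /orP[/setDP[xY _]|/gQg[r xr _]].
      by apply/disjoint_setP: x xY; exact: Hd.
    apply/disjoint_setP: x xr; apply: gad_disjoint => //.
    by apply: contraNneq ne => -[->].
have DP x : x \in D -> x \in YS \/ exists2 r, r \in J & x \in gad S r.
  move=> xD; have : x \in D :|: gQ by rewrite in_setU xD.
  by rewrite eD in_setU => /orP[|/bigcupP[r]]; [left | right; exists r].
have gadZ x r S' r' : x \in gad S r -> S' \in Z :\ S -> x \notin gad S' r'.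
  move=> xr /setD1P[ne S'Z]; have [cS' _] := HZ _ S'Z.
  apply/disjoint_setP: x xr; apply: gad_disjoint => //.
  by apply: contraNneq ne => -[->].
have YZ x S' r' : x \in Y -> S' \in Z -> x \notin gad S' r'.
  by move=> xY S'Z; apply/disjoint_setP: x xY; exact: Hd.
(* Three pieces: what [absorb_at] decomposes, the spoiled gadgets at [S], and the instance solved by
   induction. *)
have -> : Y :|: \bigcup_(S' in Z) \bigcup_(r in [set: 'I_R]) gad S' r =
    (D :|: \bigcup_(r in ~: J) gad S r) :|:
    (Y' :|: \bigcup_(S' in Z :\ S) \bigcup_(r in [set: 'I_R]) gad S' r).
  have splitJ : \bigcup_(r in [set: 'I_R]) gad S r =
      \bigcup_(r in J) gad S r :|: \bigcup_(r in ~: J) gad S r.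
    by rewrite -bigcup_setU setUCr.
  rewrite (big_setD1 S SZ) /= splitJ /Y'.
  apply/setP=> x; have/setP/(_ x) := eD; have := subsetP YSY x.
  rewrite !in_setU in_setD.
  case: (x \in YS) => [/(_ isT)->|_] /= => [|<-].
    by case: (x \in D) => //=; case: (x \in gQ) => //= _; rewrite ?orbT.
  by case: (x \in D); case: (x \in gQ); rewrite /= ?orbT ?orbF //;
    by case: (x \in Y); case: (x \in \bigcup_(r in ~: J) gad S r).
apply: dec_disjU => //.
  apply: dec_disjU => //; first exact: dec_gads.
  apply/disjoint_setP => x /DP[xYS|[r rJ xr]].
    by apply/negP => /bigcupP[r _]; apply/negP; apply: YZ => //; exact: (subsetP YSY).
  apply/negP => /bigcupP[r']; rewrite inE => r'J; apply/negP.
  apply/disjoint_setP: x xr; apply: gad_disjoint => //.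
  by apply: contraNneq r'J => -[<-].
apply/disjoint_setP => x; rewrite !in_setU !negb_or => /orP[xD|/bigcupP[r rJ xr]].
  rewrite (disjointFr djD xD) andbT in_setD.
  case: (DP _ xD) => [xYS|[r rJ xr]].
    rewrite xYS /=; apply/negP => /bigcupP[S' /setD1P[_ S'Z] /bigcupP[r' _]]; apply/negP.
    by apply: YZ => //; exact: (subsetP YSY).
  rewrite negb_and (contraL (fun h => YZ x S r h SZ)) // orbT /=.
  apply/negP => /bigcupP[S' S'Z /bigcupP[r' _]]; apply/negP; exact: gadZ xr S'Z.
rewrite in_setD negb_and (contraL (fun h => YZ x S r h SZ)) // orbT /=.
apply/andP; split.
  apply/imsetP => -[r' r'Q ex]; have r'J := subsetP QJ _ r'Q.
  have [[_ _ _ gA' _] _] := gadgets r' cS.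
  have xr' : x \in gad S r' by rewrite ex inE gA' orbT.
  have d : [disjoint gad S r & gad S r'].
    by apply: gad_disjoint => //; rewrite inE in rJ; apply: contraNneq rJ => -[->].
  by rewrite (disjointFr d xr) in xr'.
apply/negP => /bigcupP[S' S'Z /bigcupP[r' _]]; apply/negP; exact: gadZ xr S'Z.
Qed.

End Absorption.

(** * Gadgets *)

Lemma mem_flatten_iota (T : eqType) (Y : nat -> seq T) n v :
  reflect (exists2 i, i < n & v \in Y i) (v \in flatten [seq Y i | i <- iota 0 n]).
Proof.
apply: (iffP flattenP) => [[y /mapP[i]]|[i ni vi]].
  by rewrite mem_iota => /andP[_ ni] -> vi; exists i.
by exists (Y i) => //; apply/mapP; exists i; rewrite ?mem_iota.
Qed.

Lemma flatten_iotaS (T : Type) (Y : nat -> seq T) n :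
  flatten [seq Y i | i <- iota 0 n.+1] = flatten [seq Y i | i <- iota 0 n] ++ Y n.
Proof. by rewrite -addn1 iotaD map_cat flatten_cat /= cats0. Qed.

Lemma uniq_flatten_iota (T : eqType) (Y : nat -> seq T) n :
  uniq (flatten [seq Y i | i <- iota 0 n]) ->
  (forall i, i < n -> uniq (Y i)) /\
  forall i j v, i < n -> j < n -> i != j -> v \in Y i -> v \notin Y j.
Proof.
elim: n => [|n IH]; first by split.
rewrite flatten_iotaS cat_uniq => /and3P[/IH[u1 u2] /hasPn d un].
have d' i v : i < n -> v \in Y i -> v \notin Y n.
  by move=> ni vi; apply: contraL (introT (mem_flatten_iota Y n v) (ex_intro2 _ _ i ni vi)) => /d.
split=> [i|i j v]; first by rewrite ltnS leq_eqVlt => /orP[/eqP->|/u1].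
rewrite !ltnS leq_eqVlt (leq_eqVlt j) => /orP[/eqP->|ni] /orP[/eqP->|nj].
- by rewrite eqxx.
- by move=> _ vn; apply: contraL vn => /(d' _ _ nj).
- by move=> _ /(d' _ _ ni).
- exact: u2.
Qed.

Lemma win_meets k (V : finType) (s y o : seq V) i :
  0 < k -> 0 < size y -> size s < i + k -> i < size s + size y ->
  exists2 v, v \in y & v \in win k (s ++ y ++ o) i.
Proof.
move=> k0 y0 si iy; have v0 : V by case: (y) y0.
have lt : maxn i (size s) - size s < size y by lia.
have lt1 : i <= maxn i (size s) < i + k by lia.
have lt2 : maxn i (size s) < size s + (size y + size o) by lia.
exists (nth v0 (s ++ y ++ o) (maxn i (size s))); last first.
  by apply: mem_win; rewrite ?size_cat.
rewrite nth_cat ltnNge leq_maxr /= nth_cat lt; exact: mem_nth.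
Qed.

Lemma bigcup_seqP (I : eqType) (T : finType) (r : seq I) (F : I -> {set T}) e :
  reflect (exists2 i, i \in r & e \in F i) (e \in \bigcup_(i <- r) F i).
Proof.
elim: r => [|i r IH]; first by rewrite big_nil inE; constructor => -[].
rewrite big_cons inE; apply: (iffP orP) => [[ei|/IH[j jr ej]]|[j]].
- by exists i; rewrite ?inE ?eqxx.
- by exists j; rewrite // inE jr orbT.
- by rewrite inE => /orP[/eqP->|jr ej]; [left | right; apply/IH; exists j].
Qed.

Section GadgetWords.
Variables (k m h : nat) (V : finType) (E : {set {set V}}).
Hypotheses (h0 : 0 < h) (mkh : m %| k + h).
Variables (a b z : V) (A0 u : seq V) (Y O : nat -> seq V).
Hypothesis sA : (size A0).+2 = k.

(** The vertices of a gadget outside [a :: A0] and [b :: A0], listed as one word so that gadgets can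
    be counted as words. The [Y i] are connecting walks, and [z] completes [b :: A0] to the edge
    given away in a trade. *)
Definition gword := u ++ z :: flatten [seq Y i | i <- iota 0 m.+2].
Definition spath i := a :: A0 ++ Y i ++ O i.
Definition tpath := z :: b :: A0 ++ Y m.+1 ++ O m.+1.

(* The paths [spath i], for [i <= m], run from [a :: A0] to the windows of the path
   [u], and [tpath] runs from [b :: A0] to the initial window of [u]. *)
Definition gword_spec :=
  [/\ size u = k + m,
      forall i, i <= m.+1 -> size (Y i) = h /\ size (O i) = k,
      forall i, i <= m -> [set v in O i] = win k u i /\ all_win k E (spath i),
      [set v in O m.+1] = win k u 0 /\ all_win k E tpath &
      uniq (a :: A0 ++ gword) /\ uniq (b :: A0 ++ gword)].

Definition footprint : {set {set V}} :=
  [set f : {set V} | (#|f| == k) && ((f \subset a :: A0 ++ gword) || (f \subset b :: A0 ++ gword))].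

Hypothesis spec : gword_spec.

Let k0 : 0 < k. Proof. by rewrite -sA. Qed.

Let sA1 : (size A0).+1 = k.-1. Proof. by rewrite -sA. Qed.

Let Mq : k.-1 + h + 1 = k + h. Proof. by rewrite addn1 -!addSn prednK. Qed.

Let ug : [/\ uniq u, forall v, v \in z :: flatten [seq Y i | i <- iota 0 m.+2] -> v \notin u,
  z \notin flatten [seq Y i | i <- iota 0 m.+2] & uniq (flatten [seq Y i | i <- iota 0 m.+2])].
Proof.
case: spec => _ _ _ _ [+ _]; rewrite cons_uniq cat_uniq /gword cat_uniq => /and4P[_ _ _].
by rewrite cons_uniq => /and4P[? /hasPn].
Qed.

Let uflat : uniq (flatten [seq Y i | i <- iota 0 m.+2]). Proof. by case: ug. Qed.

Let Yuniq i : i <= m.+1 -> uniq (Y i).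
Proof. by move=> im; have [h1 _] := uniq_flatten_iota uflat; apply: h1. Qed.

Let Ydisj i j v : i <= m.+1 -> j <= m.+1 -> i != j -> v \in Y i -> v \notin Y j.
Proof. by move=> im jm; have [_ h1] := uniq_flatten_iota uflat; apply: h1. Qed.

Let Yflat i v : i <= m.+1 -> v \in Y i -> v \in flatten [seq Y i | i <- iota 0 m.+2].
Proof. by move=> im vi; apply/mem_flatten_iota; exists i. Qed.

Let Ygw i v : i <= m.+1 -> v \in Y i -> v \in gword.
Proof. by move=> im vi; rewrite mem_cat inE (Yflat im vi) !orbT. Qed.

Let uu : uniq u. Proof. by case: ug. Qed.

Let Yu i v : i <= m.+1 -> v \in Y i -> v \notin u.
Proof. by move=> im vi; case: ug => _ d _ _; apply: d; rewrite inE (Yflat im vi) orbT. Qed.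

Let zu : z \notin u.
Proof. by case: ug => _ d _ _; apply: d; rewrite inE eqxx. Qed.

Let Yz i : i <= m.+1 -> z \notin Y i.
Proof. by move=> im; case: ug => _ _ + _; apply: contra; exact: Yflat. Qed.

Let uA : uniq A0.
Proof. by case: spec => _ _ _ _ [+ _]; rewrite /= !cat_uniq => /and3P[]. Qed.

Let aA : a \notin A0.
Proof. by case: spec => _ _ _ _ [+ _]; rewrite /= mem_cat negb_or => /andP[/andP[]]. Qed.

Let bA : b \notin A0.
Proof. by case: spec => _ _ _ _ [_]; rewrite /= mem_cat negb_or => /andP[/andP[]]. Qed.

Let ga v : v \in gword -> (v \notin A0) && (v != a).
Proof.
case: spec => _ _ _ _ [+ _]; rewrite /= mem_cat negb_or cat_uniq => /andP[/andP[_ ag] /and3P[_ /hasPn d _]] vg.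
by rewrite d //; apply: contraNneq ag => <-.
Qed.

Let gb v : v \in gword -> (v \notin A0) && (v != b).
Proof.
case: spec => _ _ _ _ [_]; rewrite /= mem_cat negb_or cat_uniq => /andP[/andP[_ ag] /and3P[_ /hasPn d _]] vg.
by rewrite d //; apply: contraNneq ag => <-.
Qed.

Let Ou i v : i <= m.+1 -> v \in O i -> v \in u.
Proof.
move=> im vO; have : v \in [set v in O i] by rewrite inE.
move: im; rewrite leq_eqVlt => /orP[/eqP->|].
  by case: spec => _ _ _ [-> _] _ /(subsetP (win_sub _ _ _)); rewrite inE.
by case: spec => _ _ h1 _ _ /h1[-> _] /(subsetP (win_sub _ _ _)); rewrite inE.
Qed.

Let ugw v : v \in u -> v \in gword. Proof. by rewrite mem_cat => ->. Qed.

Let Ouniq i : i <= m.+1 -> uniq (O i).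
Proof.
move=> im; apply/card_uniqP; case: spec => su h1 h2 [h3 _] _; have [_ ->] := h1 _ im.
move: im; rewrite leq_eqVlt => /orP[/eqP->|im]; first by rewrite -cardsE h3 card_win // su leq_addr.
by have [e _] := h2 _ im; rewrite -cardsE e card_win // su addnC leq_add2l.
Qed.

Let YO i : i <= m.+1 -> uniq (Y i ++ O i).
Proof.
move=> im; rewrite cat_uniq Yuniq // Ouniq // andbT; apply/hasPn => v /(Ou im) vu.
by apply: contraL vu; exact: Yu.
Qed.

Let YOgw i v : i <= m.+1 -> v \in Y i ++ O i -> v \in gword.
Proof. by move=> im; rewrite mem_cat => /orP[|/(Ou im)]; [exact: Ygw | exact: ugw]. Qed.

Let spath_uniq i : i <= m.+1 -> uniq (spath i).
Proof.
move=> im; rewrite /= mem_cat (negPf aA) cat_uniq uA YO // andbT /=; apply/andP; split.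
  by apply/negP => /(YOgw im)/ga; rewrite eqxx andbF.
by apply/hasPn => v /(YOgw im)/ga/andP[].
Qed.

Let zgw : z \in gword. Proof. by rewrite mem_cat inE eqxx orbT. Qed.

Let tpath_uniq : uniq tpath.
Proof.
rewrite /= inE !mem_cat (negPf bA) cat_uniq uA YO // andbT /= !negb_or.
have /andP[-> ->] := gb zgw; rewrite Yz //=; apply/and3P; split.
- by apply: contra zu; apply: Ou.
- by rewrite -negb_or -mem_cat; apply/negP => /YOgw -/(_ (leqnn _))/gb; rewrite eqxx andbF.
- by apply/hasPn => v /YOgw -/(_ (leqnn _))/gb/andP[].
Qed.

Let size_spath i : i <= m.+1 -> size (spath i) = k.-1 + h + k.
Proof.
move=> im; case: spec => _ h1 _ _ _; have [h2 h3] := h1 _ im.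
by rewrite /= !size_cat h2 h3 -!addSn ?sA ?sA1 addnA.
Qed.

Let size_tpath : size tpath = k + h + k.
Proof.
case: spec => _ h1 _ _ _; have [h2 h3] := h1 _ (leqnn _).
by rewrite /= !size_cat h2 h3 -!addSn ?sA ?sA1 addnA.
Qed.

(** All of the [k + h] windows of [spath i] but the last, [win k u i]; a token put in front restores
    the number [k + h], a multiple of [m]. *)
Definition score i := wins k (spath i) 0 (k.-1 + h).
(** The first window of [tpath], which is the edge to be given away, and the last, [win k u 0], are
    omitted. *)
Definition tcore := wins k tpath 1 (k.-1 + h).

Let spath_last i : i <= m -> win k (spath i) (k.-1 + h) = win k u i.
Proof.
move=> im; case: spec => _ h1 h2 _ _; have [sY sO] := h1 i (leqW im); have [<- _] := h2 _ im.
rewrite /spath -cat_cons catA -[k.-1 + h]addn0.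
have -> : k.-1 + h = size ((a :: A0) ++ Y i) by rewrite size_cat sY /= ?sA ?sA1.
by rewrite win_catr win_full.
Qed.

Let tpath_last : win k tpath (k + h) = win k u 0.
Proof.
case: spec => _ h1 _ [<- _] _; have [sY sO] := h1 _ (leqnn m.+1).
rewrite /tpath -!cat_cons catA -[k + h]addn0.
have -> : k + h = size ((z :: b :: A0) ++ Y m.+1) by rewrite size_cat sY /= ?sA ?sA1.
by rewrite win_catr win_full.
Qed.

Let wins_spath i : i <= m -> wins k (spath i) 0 (k + h) = score i :|: [set win k u i].
Proof. by move=> im; rewrite -Mq wins_cat wins1 add0n spath_last. Qed.

Let wins_tpath : wins k tpath 1 (k + h) = tcore :|: [set win k u 0].
Proof. by rewrite -{1}Mq wins_cat wins1 (addnC 1) Mq tpath_last. Qed.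

Let wins_tpath0 : wins k tpath 0 (k + h) = win k tpath 0 |: tcore.
Proof. by rewrite -{1}Mq addnC wins_cat wins1. Qed.

(** Only [k - 1] letters precede [Y i] in [spath i], so each of these windows reaches [Y i]. As the
    [Y i] are pairwise disjoint, such a vertex tells the cores apart. *)
Let score_mark i e : i <= m -> e \in score i -> exists2 v, v \in Y i & v \in e.
Proof.
move=> im /winsP[j /andP[_ hj] ->]; have im' : i <= m.+1 by exact: leqW.
have sz := size_spath im'; have [sY _] : size (Y i) = h /\ size (O i) = k by case: spec => _ + _ _ _; apply.
rewrite /spath -cat_cons; apply: win_meets; rewrite ?sY //=.
- by rewrite sA1 (leq_trans (ltnSn _)) // prednK // leq_addl.
- by rewrite sA1.
Qed.

Let tcore_mark e : e \in tcore -> exists2 v, v \in Y m.+1 & v \in e.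
Proof.
move=> /winsP[j /andP[j0 hj] ->].
have sz := size_tpath; have [sY _] : size (Y m.+1) = h /\ size (O m.+1) = k by case: spec => _ + _ _ _; apply.
have hj' : j < k + h by apply: leq_trans hj _; rewrite (addnC 1) Mq.
rewrite /tpath -!cat_cons; apply: win_meets; rewrite ?sY //= ?sA.
- by rewrite -[X in X < _]add0n ltn_add2r.
- by [].
Qed.

Let score_sub i e v : e \in score i -> v \in e -> v \in spath i.
Proof. by move=> /winsP[j _ ->] /(subsetP (win_sub _ _ _)); rewrite inE. Qed.

Let tcore_sub e v : e \in tcore -> v \in e -> v \in tpath.
Proof. by move=> /winsP[j _ ->] /(subsetP (win_sub _ _ _)); rewrite inE. Qed.

Let mark_spath i j v : i <= m.+1 -> j <= m.+1 -> i != j -> v \in Y j -> v \notin spath i.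
Proof.
move=> im jm ij vj; have vg := Ygw jm vj; have /andP[vA va] := ga vg.
rewrite inE !mem_cat !negb_or va vA (Ydisj jm im _ vj) 1?eq_sym //=.
by apply: contraL vj => /(Ou im) vu; apply: contraL vu => vj; exact: Yu vj.
Qed.

Let mark_tpath j v : j <= m -> v \in Y j -> v \notin tpath.
Proof.
move=> jm vj; have jm' := leqW jm; have vg := Ygw jm' vj; have /andP[vA vb] := gb vg.
rewrite !inE !mem_cat !negb_or vb vA (Ydisj jm' (leqnn _) _ vj) /=; last by rewrite neq_ltn ltnS jm.
apply/andP; split; first by apply: contraTneq vj => ->; exact: Yz.
by apply: contraL vj => /(Ou (leqnn _)) vu; apply: contraL vu => vj; exact: Yu vj.
Qed.

Let spath_gw i v : i <= m.+1 -> v \in spath i -> v \in a :: A0 ++ gword.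
Proof.
move=> im; rewrite inE mem_cat => /or3P[/eqP->|vA|/(YOgw im) vg].
- by rewrite inE eqxx.
- by rewrite inE mem_cat vA orbT.
- by rewrite inE mem_cat vg !orbT.
Qed.

Let tpath_gw v : v \in tpath -> v \in b :: A0 ++ gword.
Proof.
rewrite inE inE mem_cat => /or4P[/eqP->|/eqP->|vA|/(YOgw (leqnn _)) vg].
- by rewrite inE mem_cat zgw !orbT.
- by rewrite inE eqxx.
- by rewrite inE mem_cat vA orbT.
- by rewrite inE mem_cat vg !orbT.
Qed.

Let wins_spath_foot i : i <= m -> wins k (spath i) 0 (k + h) \subset footprint.
Proof.
move=> im; have im' := leqW im; apply/subsetP=> e /winsP[j /andP[_ hj] ->].
rewrite inE card_win ?spath_uniq ?eqxx //; last first.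
  by rewrite size_spath // leq_add2r -ltnS -[X in _ < X]addn1 Mq.
apply/orP; left; apply/subsetP=> v /(subsetP (win_sub _ _ _)); rewrite inE.
exact: spath_gw.
Qed.

Let wins_tpath_foot : wins k tpath 0 (k + h) \subset footprint.
Proof.
apply/subsetP=> e /winsP[j /andP[_ hj] ->].
rewrite inE card_win ?tpath_uniq ?eqxx //; last first.
  by rewrite size_tpath // leq_add2r ltnW.
apply/orP; right; apply/subsetP=> v /(subsetP (win_sub _ _ _)); rewrite inE.
exact: tpath_gw.
Qed.

Let score_u i j : i <= m -> win k u j \notin score i.
Proof.
move=> im; apply/negP => /(score_mark im)[v vY].
by move=> /(subsetP (win_sub _ _ _)); rewrite inE; apply/negP; apply: Yu vY; exact: leqW.
Qed.

Let tcore_u j : win k u j \notin tcore.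
Proof.
apply/negP => /tcore_mark[v vY].
by move=> /(subsetP (win_sub _ _ _)); rewrite inE; apply/negP; apply: Yu vY.
Qed.

Let win_u_inj i j : i <= m -> j <= m -> win k u i = win k u j -> i = j.
Proof.
move=> im jm; case: spec => su _ _ _ _; apply: win_inj => //.
  by rewrite su addnC leq_add2l.
by rewrite su addnC leq_add2l.
Qed.

Let score_score i j : i <= m -> j <= m -> i != j -> [disjoint score i & score j].
Proof.
move=> im jm ij; apply/disjoint_setP => e /(score_mark im)[v vi ve].
apply/negP => /score_sub/(_ ve); apply/negP; apply: mark_spath vi; rewrite ?leqW //.
by rewrite eq_sym.
Qed.

Let score_tcore i : i <= m -> [disjoint score i & tcore].
Proof.
move=> im; apply/disjoint_setP => e /(score_mark im)[v vi ve].
by apply/negP => /tcore_sub/(_ ve); apply/negP; apply: mark_tpath vi.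
Qed.

Let tedge := win k tpath 0.

Let z_tedge : z \in tedge.
Proof. by rewrite /tedge /win drop0 inE -(prednK k0) /= inE eqxx. Qed.

Let tcore_z e : e \in tcore -> z \notin e.
Proof.
rewrite /tcore wins_cons => /winsP[j _ ->]; apply/negP => /(subsetP (win_sub _ _ _)).
by rewrite inE; apply/negP; case/andP: tpath_uniq.
Qed.

Let spath_z i : i <= m -> z \notin spath i.
Proof.
move=> im; have /andP[zA za] := ga zgw; rewrite inE !mem_cat !negb_or za zA Yz ?leqW //=.
by apply: contra zu; apply: Ou; exact: leqW.
Qed.

Let tedge_score i : i <= m -> tedge \notin score i.
Proof. by move=> im; apply/negP => /score_sub/(_ z_tedge); apply/negP; exact: spath_z. Qed.

Let tedge_u i : tedge != win k u i.
Proof.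
apply: contraTneq z_tedge => ->; apply/negP => /(subsetP (win_sub _ _ _)).
by rewrite inE (negPf zu).
Qed.

Let tedge_tcore : tedge \notin tcore.
Proof. by apply: contraL z_tedge => /tcore_z. Qed.

Let dec_spath i : i <= m -> dec k m (wins k (spath i) 0 (k + h)).
Proof.
move=> im; have im' := leqW im; rewrite -(divnK mkh); apply: dec_wins => //.
  exact: spath_uniq.
by rewrite divnK // size_spath // -addSn -addSn prednK.
Qed.

Let dec_tpath c : c <= 1 -> dec k m (wins k tpath c (k + h)).
Proof.
move=> c1; rewrite -(divnK mkh); apply: dec_wins => //.
by rewrite divnK // size_tpath -addSn leq_add2r -add1n leq_add2r.
Qed.

(** The vertex [y] that [x] adds to [a :: A0] lies outside the gadget, because [x] is not in the
    footprint. Hence [y :: spath i] is a path, and without its last window it has [k + h]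
    windows. *)
Let token_path i x : i <= m -> usable k footprint [set v in a :: A0] x ->
  dec k m (x |: score i) /\ x \notin score i.
Proof.
move=> im /and3P[/eqP cx Sx xF]; have im' := leqW im; split; last first.
  apply: contra xF; apply: subsetP; apply: subset_trans (wins_spath_foot im).
  by rewrite wins_spath // subsetUl.
have cS : #|[set v in a :: A0]| = k.-1.
  by rewrite cardsE (card_uniqP _) /= ?aA //.
have /eqP/cards1P[y ey] : #|x :\: [set v in a :: A0]| = 1.
  by rewrite cardsD (setIidPr Sx) cx cS -{1}(prednK k0) subSnn.
have yx : y \in x :\: [set v in a :: A0] by rewrite ey inE.
have ex : x = [set v in y :: a :: A0].
  by apply/setP=> v; have/setP/(_ v) := ey; have := subsetP Sx v; rewrite !inE;
    case: (v \in x); case: (v == a); case: (v \in A0); case: (v == y) => //= H; have := H isT.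
have yg : y \notin gword.
  apply: contra xF => yg; rewrite inE cx eqxx /=; apply/orP; left; apply/subsetP=> v.
  rewrite ex !inE mem_cat => /or3P[/eqP->|/eqP->|->]; rewrite ?eqxx ?orbT //.
  by rewrite yg !orbT.
have uy : uniq (y :: spath i).
  rewrite cons_uniq spath_uniq // andbT; apply: contra yg => /(spath_gw im').
  move: yx; rewrite !inE negb_or mem_cat => /andP[/andP[/negPf-> /negPf->] _] //.
rewrite (_ : x |: score i = wins k (y :: spath i) 0 (k + h)).
  rewrite -(divnK mkh); apply: dec_wins => //.
  have -> : size (y :: spath i) = k + h + k.
    by rewrite -[LHS]/(size (spath i)).+1 size_spath // -!addSn prednK.
  by rewrite divnK.
rewrite -Mq (addnC _ 1) wins_cat wins1 wins_cons; congr (_ |: _).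
by rewrite ex /win drop0 /spath -!cat_cons take_size_cat.
Qed.

Let dec_u : dec k m (wins k u 1 m).
Proof.
case: spec => su _ _ _ _; rewrite -[m in wins _ _ _ m]mul1n; apply: dec_wins => //.
by rewrite mul1n su add1n addSn addnC.
Qed.

(** The reserved part [K]. At rest each [spath i] is decomposed alone; with a token in front of each
    of the [m] paths, their last windows are freed and form the single path [wins k u 1 m]. *)
Let sink := \bigcup_(i <- iota 1 m) wins k (spath i) 0 (k + h).
(** The part [A]. At rest [win k u 0] is the end of [spath 0]; once a token enters in front of
    [spath 0], this window serves as the end of [tpath], and the first window [tedge] of [tpath] is
    released. *)
Let arc := (score 0 :|: [set win k u 0]) :|: (tedge |: tcore).

Let sinkP e : reflect (exists2 i, 0 < i <= m & e \in score i \/ e = win k u i) (e \in sink).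
Proof.
apply: (iffP (bigcup_seqP _ _ _)) => -[i im ei]; exists i; move: im; rewrite ?mem_iota ?add1n ?ltnS //.
  by move=> /andP[_ im]; move: ei; rewrite wins_spath // inE in_set1 => /orP[|/eqP]; [left|right].
by move=> /andP[_ im]; rewrite wins_spath // inE in_set1; case: ei => ->; rewrite ?eqxx ?orbT.
Qed.

Let arcP e : (e \in arc) = [|| e \in score 0, e == win k u 0, e == tedge | e \in tcore].
Proof. by rewrite !in_setU !in_set1 -orbA. Qed.

Let arc_split : arc = wins k (spath 0) 0 (k + h) :|: wins k tpath 0 (k + h).
Proof. by rewrite wins_spath // wins_tpath0. Qed.

Let arc_trade : arc :\ tedge = score 0 :|: wins k tpath 1 (k + h).
Proof.
rewrite wins_tpath; apply/setP=> e; rewrite !in_setU in_setD1 arcP !in_set1.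
have [->|_] := eqVneq e tedge.
  by rewrite (negPf (tedge_u 0)) (negPf (tedge_score (leq0n m))) (negPf tedge_tcore).
by case: (e \in score 0); case: (e == win k u 0); rewrite ?orbT ?orbF //; case: (e \in tcore).
Qed.

Let u_arc i e : 0 < i <= m -> e = win k u i -> e \notin arc.
Proof.
move=> /andP[i0 im] ->; rewrite arcP (negPf (score_u i (leq0n m))) (negPf (tcore_u i)).
rewrite eq_sym [_ == tedge]eq_sym (negPf (tedge_u i)) !orbF; apply/eqP => /(win_u_inj (leq0n _) im) i0'.
by rewrite -i0' in i0.
Qed.

Let score_arc i e : 0 < i <= m -> e \in score i -> e \notin arc.
Proof.
move=> /andP[i0 im] ei; rewrite arcP (disjointFr (score_tcore im) ei).
have ni : i != 0 by rewrite -lt0n.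
rewrite (disjointFr (score_score im (leq0n m) ni) ei) orbF /= negb_or; apply/andP; split.
  by apply: contraTneq ei => ->; exact: score_u.
by apply: contraTneq ei => ->; exact: tedge_score.
Qed.

Let dec_sink : dec k m sink.
Proof.
apply: dec_bigcup => [|i|i j]; rewrite ?iota_uniq // !mem_iota add1n ltnS.
  by move=> /andP[_ im]; exact: dec_spath.
rewrite ltnS => /andP[_ im] /andP[_ jm] ij.
rewrite !wins_spath //; apply/disjoint_setP => e; rewrite !in_setU !in_set1 => /orP[ei|/eqP->].
  rewrite (disjointFr (score_score im jm ij) ei) /=.
  by apply: contraTneq ei => ->; exact: score_u.
rewrite (negPf (score_u i jm)) /=; apply: contra ij => /eqP /(win_u_inj im jm) ->.
by [].
Qed.

Let dec_arc : dec k m arc.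
Proof.
rewrite arc_split; apply: dec_disjU; [exact: dec_spath | exact: dec_tpath |].
rewrite wins_spath // wins_tpath0; apply/disjoint_setP => e; rewrite !in_setU !in_set1 => /orP[e0|/eqP->].
  rewrite (disjointFr (score_tcore (leq0n m)) e0) orbF.
  by apply: contraTneq e0 => ->; exact: tedge_score.
by rewrite (negPf (tcore_u 0)) orbF eq_sym; exact: tedge_u.
Qed.

Let dec_arc_trade x : usable k footprint [set v in a :: A0] x -> dec k m (x |: (arc :\ tedge)).
Proof.
move=> ux; have [dx xs] := token_path (leq0n m) ux.
rewrite arc_trade setUA; apply: dec_disjU => //; first exact: dec_tpath.
rewrite wins_tpath; apply/disjoint_setP => e; rewrite !in_setU !in_set1 => /orP[/eqP->|e0].
  have [_ _ xF] := and3P ux; rewrite negb_or; apply/andP; split.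
    apply: contra xF; apply: subsetP; apply: subset_trans wins_tpath_foot.
    by rewrite wins_tpath0 subsetUr.
  apply: contraNneq xF => ->; apply: (subsetP (wins_spath_foot (leq0n m))).
  by rewrite wins_spath // in_setU in_set1 eqxx orbT.
rewrite (disjointFr (score_tcore (leq0n m)) e0) /=.
by apply: contraTneq e0 => ->; exact: score_u.
Qed.

Let dec_sink_tokens (X : {set {set V}}) : #|X| = m ->
  (forall x, x \in X -> usable k footprint [set v in a :: A0] x) -> dec k m (sink :|: X).
Proof.
(* Tokens are numbered from 1 to match the paths of [sink]. *)
move=> cX uX; pose x i := nth set0 (enum X) i.-1.
have sX : size (enum X) = m by rewrite -cardE.
have xX i : 0 < i <= m -> x i \in X.
  by move=> /andP[i0 im]; rewrite -mem_enum mem_nth // sX -ltnS prednK.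
have xinj i j : 0 < i <= m -> 0 < j <= m -> x i = x j -> i = j.
  move=> /andP[i0 im] /andP[j0 jm] /eqP; rewrite nth_uniq ?enum_uniq ?sX ?prednK //.
  by move=> /eqP ij; rewrite -(prednK i0) ij prednK.
have xF i y : 0 < i <= m -> y \in footprint -> y != x i.
  by move=> im; apply: contraTneq => ->; have /and3P[] := uX _ (xX _ im).
have -> : sink :|: X = \bigcup_(i <- iota 1 m) (x i |: score i) :|: wins k u 1 m.
  apply/setP=> e; rewrite !in_setU; apply/orP/orP => [[/sinkP[i im [ei|->]]|eX]|].
  - by left; apply/bigcup_seqP; exists i; rewrite ?mem_iota ?add1n ?ltnS // in_setU ei orbT.
  - by right; apply/winsP; exists i; rewrite ?add1n ?ltnS.
  - left; have ie : index e (enum X) < m by rewrite -sX index_mem mem_enum.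
    apply/bigcup_seqP; exists (index e (enum X)).+1; first by rewrite mem_iota add1n ltnS.
    by rewrite in_setU in_set1 /x /= nth_index ?mem_enum // eqxx.
  - case=> [/bigcup_seqP[i]|/winsP[i]]; rewrite ?mem_iota ?add1n ?ltnS => im.
      rewrite in_setU in_set1 => /orP[/eqP->|ei]; first by right; exact: xX.
      by left; apply/sinkP; exists i; rewrite //; left.
    by move=> ->; left; apply/sinkP; exists i; rewrite //; right.
have foot i : 0 < i <= m -> wins k (spath i) 0 (k + h) \subset footprint.
  by move=> /andP[_ im]; exact: wins_spath_foot.
apply: dec_disjU => //.
  apply: dec_bigcup => [|i|i j]; rewrite ?iota_uniq // !mem_iota add1n ltnS => im.
    by have [] := token_path (proj2 (andP im)) (uX _ (xX _ im)).
  rewrite ltnS => jm ij; have [_ im'] := andP im; have [_ jm'] := andP jm.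
  apply/disjoint_setP => e; rewrite !in_setU !in_set1 => /orP[/eqP->|ei].
    rewrite negb_or; apply/andP; split; first by apply: contra ij => /eqP/xinj->.
    apply: contraL isT => ej; rewrite -(xF i (x i) im) ?eqxx //.
    by apply: (subsetP (foot _ jm)); rewrite wins_spath // in_setU ej.
  rewrite (disjointFr (score_score im' jm' ij) ei) orbF; apply: xF => //.
  by apply: (subsetP (foot _ im)); rewrite wins_spath // in_setU ei.
apply/disjoint_setP => e /bigcup_seqP[i]; rewrite mem_iota add1n ltnS => im ei.
apply/negP => /winsP[j]; rewrite add1n ltnS => jm ej; have [_ im'] := andP im.
have [_ jm'] := andP jm; move: ei; rewrite ej in_setU in_set1 (negPf (score_u j im')) orbF.
apply/negP; apply: xF => //; apply: (subsetP (foot _ jm)).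
by rewrite wins_spath // in_setU in_set1 eqxx orbT.
Qed.

Lemma gword_gadget : exists K A g,
  gadget k m [set v in a :: A0] [set v in b :: A0] footprint K A g /\ K :|: A \subset E.
Proof.
exists sink, arc, tedge; split; last first.
  case: spec => _ _ h2 [_ h3] _; have spE i : i <= m -> wins k (spath i) 0 (k + h) \subset E.
    move=> im; have [_ aw] := h2 _ im; apply/subsetP=> e /winsP[j /andP[_ hj] ->]; apply: aw.
    by rewrite size_spath ?leqW // leq_add2r -ltnS -[X in _ < X]addn1 Mq.
  rewrite arc_split !subUset spE // andTb; apply/andP; split.
    by apply/subsetP=> e /bigcup_seqP[i]; rewrite mem_iota add1n ltnS => /andP[_ im]; apply/subsetP/spE.
  apply/subsetP=> e /winsP[j /andP[_ hj] ->]; apply: h3.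
  by rewrite size_tpath leq_add2r ltnW.
split; split => //.
- by apply/disjoint_setP => e /sinkP[i im [ei|ei]]; [exact: score_arc im ei | exact: u_arc im ei].
- by apply/subsetP=> e /bigcup_seqP[i]; rewrite mem_iota add1n ltnS => /andP[_ im]; apply/subsetP/wins_spath_foot.
- by rewrite arc_split subUset wins_spath_foot.
- by rewrite arcP eqxx !orbT.
- rewrite /tedge /win drop0 /tpath -!cat_cons take_size_cat //.
  by apply/subsetP=> v; rewrite !inE => ->; rewrite orbT.
Qed.

End GadgetWords.

(** * Counting words *)

Section Counting.
Variable V : finType.
Implicit Types (P Q : seq V -> Prop) (f S : {set V}) (w s u : seq V).

Definition cnt n P : nat := #|[set t : n.-tuple V | `[< P t >]]|.

Lemma cnt_le n P Q : (forall w, size w = n -> P w -> Q w) -> cnt n P <= cnt n Q.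
Proof.
move=> PQ; apply: subset_leq_card; apply/subsetP=> t; rewrite !inE => /asboolP Pt.
by apply/asboolP/PQ; rewrite ?size_tuple.
Qed.

Lemma eq_cnt n P Q : (forall w, size w = n -> P w <-> Q w) -> cnt n P = cnt n Q.
Proof. by move=> PQ; apply/eqP; rewrite eqn_leq !cnt_le // => w /PQ[]. Qed.

Lemma cntT n P : cnt n P <= #|V| ^ n.
Proof. by rewrite -card_tuple; apply: leq_trans (max_card _) _. Qed.

Lemma cntU n P Q : cnt n (fun w => P w \/ Q w) <= cnt n P + cnt n Q.
Proof.
apply: leq_trans (leq_card_setU _ _); apply: subset_leq_card; apply/subsetP=> t.
by rewrite !inE => /asboolP[p|p]; apply/orP; [left|right]; apply/asboolP.
Qed.

Lemma cnt_sum a b P : cnt (a + b) P = \sum_(u : a.-tuple V) cnt b (fun v => P (u ++ v)).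
Proof.
have szt (t : (a + b).-tuple V) : size (take a t) == a.
  by rewrite size_takel // size_tuple leq_addr.
pose tk (t : (a + b).-tuple V) : a.-tuple V := Tuple (szt t).
rewrite /cnt -sum1_card (partition_big tk predT) //=; apply: eq_bigr => u _.
rewrite sum1dep_card -(card_imset _ (f := fun v : b.-tuple V => [tuple of u ++ v])).
  apply: eq_card => t; rewrite !inE; apply/andP/imsetP => [[Pt /eqP tu]|[v]].
    have szd : size (drop a t) == b by rewrite size_drop size_tuple addKn.
    have et : t = u ++ drop a t :> seq V by rewrite -tu /= cat_take_drop.
    exists (Tuple szd); last by apply: val_inj.
    by rewrite inE /= -et.
  rewrite inE => Pv ->; split=> //; apply/eqP/val_inj => /=.
  by rewrite take_size_cat // size_tuple.
by move=> v v' /(congr1 val)/= /eqP; rewrite eqseq_cat // eqxx => /eqP/val_inj.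
Qed.

Lemma cnt0 P : cnt 0 P = `[< P [::] >].
Proof.
rewrite /cnt (_ : [set t | _] = if `[< P [::] >] then [set: 0.-tuple V] else set0).
  by case: ifP; rewrite ?cards0 // cardsT card_tuple.
by apply/setP=> t; rewrite inE (tuple0 t); case: ifP => // pf; rewrite inE.
Qed.

Lemma cnt1 P : cnt 1 P = #|[set v | `[< P [:: v] >]]|.
Proof.
rewrite /cnt -(card_imset _ (f := fun v : V => [tuple v])); last by move=> v v' /(congr1 val) [].
apply: eq_card => t; rewrite !inE; apply/idP/imsetP => [|[v]]; last by rewrite inE => p ->.
by case/tupleP: t => v t; rewrite tuple0 => p; exists v; rewrite ?inE //; apply: val_inj.
Qed.

Lemma cntS n P : cnt n.+1 P = \sum_(v : V) cnt n (fun w => P (v :: w)).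
Proof.
rewrite -add1n cnt_sum (reindex (fun v : V => [tuple v])) /=; last first.
  exists (fun t => thead t) => // t _; case/tupleP: t => v t.
  by rewrite tuple0; apply: val_inj.
by [].
Qed.

Lemma cnt_set_sum c n P :
  \sum_(S : {set V} | #|S| == c) cnt n (fun w => P (enum S ++ w)) <= cnt (c + n) P.
Proof.
rewrite cnt_sum [X in _ <= X](partition_big (fun t : c.-tuple V => [set x in t]) predT) //=.
rewrite [X in _ <= X](bigID (fun S : {set V} => #|S| == c)) /=.
apply: leq_trans (leq_addr _ _); apply: leq_sum => S cS.
have sz : size (enum S) == c by rewrite -cardE.
rewrite (bigD1 (Tuple sz)) ?leq_addr //=.
by apply/eqP/setP=> x; rewrite inE mem_enum.
Qed.

(** There are at most [n ^ #|f|] ways to place the elements of [f], and the other letters are free.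
    The factor [#|V| ^ #|f|] on the left avoids a difference of exponents. *)
Lemma cnt_cover n f : cnt n (fun w => f \subset w) * #|V| ^ #|f| <= n ^ #|f| * #|V| ^ n.
Proof.
elim: n f => [|n IH] f.
  rewrite cnt0; have [->|[x xf]] := set_0Vmem f; first by rewrite cards0 !expn0 mul1n muln1; case: asbool.
  by case: asboolP => // /subsetP/(_ x xf).
have [->|[x xf]] := set_0Vmem f; first by rewrite cards0 !expn0 mul1n muln1 cntT.
rewrite cntS; have cf : 0 < #|f| by apply/card_gt0P; exists x.
have IH1 := IH f; move: cf IH1; case cF: #|f| => [//|j] _ IH1.
have IH2 v : v \in f -> cnt n (fun w => f :\ v \subset w) * #|V| ^ j <= n ^ j * #|V| ^ n.
  move=> vf; have cv : #|f :\ v| = j by apply/eqP; rewrite -eqSS -cF (cardsD1 v f) vf.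
    by rewrite -cv; exact: IH.
(* Split on the first letter [v]: if it lies in [f], only [f :\ v] remains to be covered. *)
have bd v : cnt n (fun w => f \subset v :: w) * #|V| ^ j.+1 <=
   n ^ j.+1 * #|V| ^ n + (v \in f) * (#|V| * (n ^ j * #|V| ^ n)).
  case vf: (v \in f); rewrite ?mul0n ?addn0 ?mul1n.
    apply: leq_trans (leq_addl _ _); rewrite expnS mulnCA leq_mul2l; apply/orP; right.
    apply: leq_trans (IH2 v vf); rewrite leq_mul2r; apply/orP; right.
    apply: cnt_le => w _ /subsetP h; apply/subsetP=> y /setD1P[yv /h].
    by rewrite inE (negPf yv).
  apply: leq_trans IH1; rewrite leq_mul2r; apply/orP; right.
  apply: cnt_le => w _ /subsetP h; apply/subsetP=> y yf; have := h y yf.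
  by rewrite inE; case: eqP => // yv; rewrite -yv yf in vf.
rewrite big_distrl /=; apply: leq_trans (leq_sum _ (fun v _ => bd v)) _.
rewrite big_split /= sum_nat_const -big_distrl /= -[\sum_(i : V) _]/(\sum_(i : V) nat_of_bool (i \in f)).
rewrite -big_mkcond sum1_card cF.
(* The first two terms of the binomial expansion. *)
have ineq : n ^ j.+1 + j.+1 * n ^ j <= n.+1 ^ j.+1.
  elim: (j) => [|i IHi]; first by rewrite !expn1 expn0; lia.
  rewrite (expnS n.+1); apply: leq_trans (leq_mul (leqnn n.+1) IHi).
  by rewrite !expnS; nia.
apply: leq_trans (leq_mul ineq (leqnn (#|V| ^ n.+1))).
by rewrite (expnS #|V|) (_ : #|pred_of_simpl _| = #|V|) //; nia.
Qed.

(** Some letter repeats an earlier one or a letter of [s]: at most [n] positions, each with fewer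
    than [size s + n] forbidden values. *)
Lemma cnt_not_uniq n s : uniq s ->
  cnt n (fun w => ~~ uniq (s ++ w)) * #|V| <= n * (size s + n) * #|V| ^ n.
Proof.
elim: n s => [|n IH] s us.
  by rewrite cnt0 cats0; case: asboolP => //; rewrite us.
rewrite cntS big_distrl /=.
have bd v : cnt n (fun w => ~~ uniq (s ++ v :: w)) * #|V| <=
    (v \in s) * #|V| ^ n.+1 + n * ((size s).+1 + n) * #|V| ^ n.
  case vs: (v \in s).
    by rewrite mul1n; apply: leq_trans (leq_addr _ _); rewrite expnSr leq_mul2r cntT orbT.
  rewrite mul0n add0n; have := IH (rcons s v); rewrite rcons_uniq vs us size_rcons => /(_ isT).
  by under eq_cnt => w _ do rewrite cat_rcons.
apply: leq_trans (leq_sum _ (fun v _ => bd v)) _.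
rewrite big_split /= sum_nat_const -big_distrl /=.
have le : \sum_(i : V) nat_of_bool (i \in s) <= size s.
  by rewrite -big_mkcond sum1_card; apply: card_size.
apply: leq_trans (leq_add (leq_mul le (leqnn _)) (leqnn _)) _.
by rewrite expnS (_ : #|pred_of_simpl _| = #|V|) //; nia.
Qed.

(** [C] is an inverse density, which keeps all bounds in the natural numbers. *)
Definition dense n C P : Prop := #|V| ^ n <= C * cnt n P.

Lemma dense_weaken n C C' P Q : C <= C' -> (forall w, size w = n -> P w -> Q w) ->
  dense n C P -> dense n C' Q.
Proof. by move=> CC PQ /leq_trans; apply; apply: leq_mul => //; exact: cnt_le. Qed.

Lemma dense1 C P : #|V| <= C * #|[set v | `[< P [:: v] >]]| -> dense 1 C P.
Proof. by rewrite /dense cnt1 expn1. Qed.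

Lemma dense_cat a b C1 C2 P Q : dense a C1 P ->
  (forall u, size u = a -> P u -> dense b C2 (fun v => Q (u ++ v))) ->
  dense (a + b) (C1 * C2) Q.
Proof.
move=> dP dQ; rewrite /dense expnD; apply: leq_trans (leq_mul dP (leqnn _)) _.
rewrite -!mulnA leq_mul2l; apply/orP; right.
rewrite cnt_sum big_distrr /=.
rewrite (bigID (fun u : a.-tuple V => `[< P u >])) /=; apply: leq_trans (leq_addr _ _).
rewrite /cnt -sum_nat_const big_mkcond [X in _ <= X]big_mkcond; apply: leq_sum => u _.
rewrite inE; case: ifP => // /asboolP Pu; apply: dQ => //; exact: size_tuple.
Qed.

Lemma dense_flatten h C (Q : nat -> seq V -> Prop) n :
  (forall i, i < n -> dense h C (Q i)) ->
  dense (n * h) (C ^ n) (fun x => exists Y : nat -> seq V,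
    x = flatten [seq Y i | i <- iota 0 n] /\ forall i, i < n -> size (Y i) = h /\ Q i (Y i)).
Proof.
elim: n => [|n IH] dQ.
  rewrite /dense cnt0 !expn0 mul1n; case: asboolP => // -[].
  by exists (fun _ => [::]).
rewrite mulSnr expnSr; apply: dense_cat; first by apply: IH => i ni; apply/dQ/ltnW.
move=> u _ [Y [-> HY]]; apply: dense_weaken (dQ n (ltnSn n)) => // y sy Qy.
exists (fun i => if i == n then y else Y i); split.
  rewrite flatten_iotaS eqxx; congr (flatten _ ++ _).
  apply/eq_in_map => i; rewrite mem_iota add0n => /andP[_ ni].
  by rewrite (ltn_eqF ni).
move=> i; rewrite ltnS leq_eqVlt; case: eqVneq => [-> //|_ /=]; exact: HY.
Qed.

(** By [cnt_not_uniq], the words repeating a letter or meeting [s1] or [s2] are at most a share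
    [1 / (2 * C)] of all words, half of what [P] guarantees. *)
Lemma dense_uniq n C P s1 s2 c : uniq s1 -> uniq s2 -> size s1 = c -> size s2 = c ->
  4 * C * (n * (c + n)) <= #|V| -> 0 < #|V| -> dense n C P ->
  dense n (2 * C) (fun w => P w /\ uniq (s1 ++ w) /\ uniq (s2 ++ w)).
Proof.
move=> u1 u2 c1 c2 large V0 dP.
have le : cnt n P <= cnt n (fun w => P w /\ uniq (s1 ++ w) /\ uniq (s2 ++ w)) +
   (cnt n (fun w => ~~ uniq (s1 ++ w)) + cnt n (fun w => ~~ uniq (s2 ++ w))).
  apply: leq_trans (leq_add (leqnn _) (cntU _ _ _)).
  apply: leq_trans (cntU _ _ _); apply: cnt_le => w _ Pw.
  case: (boolP (uniq (s1 ++ w))) => h1; last by right; left.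
  by case: (boolP (uniq (s2 ++ w))) => h2; [left | right; right].
have b1 := cnt_not_uniq n u1; have b2 := cnt_not_uniq n u2; move: b1 b2.
rewrite c1 c2; move: le dP; rewrite /dense.
move: (cnt n P) (cnt n (fun w => ~~ uniq (s1 ++ w))) (cnt n (fun w => ~~ uniq (s2 ++ w))).
move: (cnt n _) (#|V| ^ n) (n * (c + n)) large => g N B large p x y le dP b1 b2.
rewrite -(leq_pmul2l V0).
have e1 : #|V| * N <= #|V| * (C * (g + (x + y))).
  by rewrite leq_mul2l; apply/orP; right; apply: leq_trans dP _; rewrite leq_mul2l le orbT.
have e2 : 2 * (C * (x * #|V| + y * #|V|)) <= #|V| * N.
  apply: leq_trans (leq_mul large (leqnn N)).
  have : C * (x * #|V| + y * #|V|) <= C * (B * N + B * N) by rewrite leq_mul2l leq_add ?orbT.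
  by lia.
by nia.
Qed.

End Counting.

(** * Tight walks in dense k-graphs *)

Section Supersaturation.
Variables (k : nat) (V : finType).
Hypothesis k0 : 0 < k.
Implicit Types (F E : {set {set V}}) (w u : seq V).

Lemma all_win_short F w : size w < k -> all_win k F w.
Proof. by move=> sw i hi; lia. Qed.

Lemma tail_full w : size w = k.-1 -> tail k w = [set v in w].
Proof. by move=> sw; rewrite /tail sw subnn drop0. Qed.

(** Peeling with [d] about [#|V| / (2 * C)] removes at most half of the guaranteed number of edges,
    and afterwards every tail has at least [d] extensions. The bound [2 * C <= #|V|] limits the loss
    from rounding [d] to a factor 2. *)
Lemma dense_core C F j : uniform k F -> 2 * C <= #|V| -> 0 < C -> #|V| ^ k <= C * #|F| ->
  exists2 F' : {set {set V}}, F' \subset F & dense (k + j) (2 * C * (4 * C) ^ j) (all_win k F').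
Proof.
move=> uF VC C0 FC; set n := #|V|; pose d := n %/ (2 * C).
have dn : d * (2 * C) <= n by exact: leq_trunc_div.
have d0 : 0 < d by rewrite divn_gt0 // muln_gt0.
have nd : n <= 4 * C * d.
  have : n < d.+1 * (2 * C) by rewrite -ltn_divLR ?muln_gt0.
  move: d0; clear; nia.
have [F' [al [F'F dF' alF fib]]] := peel d uF; exists F' => //.
have uF' : uniform k F' by move=> e /(subsetP F'F)/uF.
have cS : #|[set S : {set V} | #|S| == k.-1]| <= n ^ k.-1.
  have := @cnt_set_sum V k.-1 0 (fun=> True); under eq_bigr do rewrite cnt0 asboolT //.
  by rewrite sum1dep_card => /leq_trans; apply; rewrite addn0 cntT.
have cD : #|F :\: F'| <= d * n ^ k.-1.
  rewrite -sum1_card (partition_big al (fun S => #|S| == k.-1)) /=; last first.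
    by move=> e /alF[_ ->].
  apply: leq_trans (_ : \sum_(S : {set V} | #|S| == k.-1) d <= _).
    by apply: leq_sum => S _; rewrite sum1dep_card; apply: leq_trans (fib S); rewrite leqnn.
  by rewrite sum_nat_cond_const mulnC leq_mul2l cS orbT.
have cF' : n ^ k <= 2 * C * #|F'|.
  have := cardsID F' F; rewrite (setIidPr F'F) => cF.
  have : 2 * C * #|F :\: F'| <= n ^ k.
    apply: leq_trans (leq_mul (leqnn _) cD) _.
    by rewrite mulnA (mulnC (2 * C)) -[in n ^ k](prednK k0) expnS leq_mul2r dn orbT.
  move: FC; rewrite -cF; rewrite -/n; move: (n ^ k) => N; clear; lia.
elim: j => [|j IH].
  rewrite muln1 addn0 /dense; apply: leq_trans cF' _; rewrite leq_mul2l; apply/orP; right.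
  rewrite -[k in cnt k]addn0; apply: leq_trans (cnt_set_sum _ _ _).
  rewrite -sum1_card [leqRHS]big_mkcond [leqLHS]big_mkcond /=; apply: leq_sum => S _.
  case: ifP => // SF; rewrite (uF' _ SF) eqxx cnt0 cats0 asboolT // => i.
  rewrite -cardE (uF' _ SF) => hi; have -> : i = 0 by lia.
  rewrite win_full -?cardE ?(uF' _ SF) // (_ : [set x in _] = S) //.
  by apply/setP=> x; rewrite inE mem_enum.
rewrite addnS -[(k + j).+1]addn1 expnSr mulnA; apply: dense_cat IH _ => u su au.
have ku : k <= size u by rewrite su leq_addr.
have cT := card_tail k0 uF' au ku; have dT := tail_degree_gt0 k0 ku au.
apply: dense1; apply: leq_trans nd _; rewrite leq_mul2l; apply/orP; right.
apply: leq_trans (dF' _ cT dT) _; rewrite -(card_ngb k0 uF' cT).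
apply: subset_leq_card; apply/subsetP=> v vT; rewrite inE; apply/asboolP.
by rewrite cats1; apply: all_win_rcons => //; lia.
Qed.

(** Averaging over the last [k] letters: the ends [t] with fewer than a share [1 / (2 * C)] of the
    beginnings account for at most half of the words in [W]. *)
Lemma dense_rich C h (W : seq V -> Prop) : dense (h + k) C W ->
  #|V| ^ k <= 2 * C * #|[set t : k.-tuple V |
      `[< dense h (2 * C) (fun y => W (y ++ t)) >]]| \/ #|V| = 0.
Proof.
move=> dW; have [|n0] := posnP #|V|; [by right | left].
set R := [set t | _].
have sw : cnt (h + k) W = \sum_(t : k.-tuple V) cnt h (fun y => W (y ++ t)).
  rewrite cnt_sum /cnt; under eq_bigr do rewrite -sum1dep_card big_mkcond.
  rewrite exchange_big /=; apply: eq_bigr => t _.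
  by rewrite -sum1dep_card [RHS]big_mkcond.
have : 2 * #|V| ^ (h + k) <= 2 * C * #|R| * #|V| ^ h + #|V| ^ k * #|V| ^ h.
  apply: leq_trans (_ : 2 * (C * cnt (h + k) W) <= _); first by rewrite leq_mul2l dW orbT.
  rewrite sw mulnA big_distrr (bigID (mem R)) /=; apply: leq_add.
    rewrite -mulnA mulnCA -sum_nat_const; apply: leq_sum => t _.
    by rewrite mulnC [X in _ <= X]mulnC leq_mul2r cntT orbT.
  apply: leq_trans (_ : \sum_(t : k.-tuple V) #|V| ^ h <= _).
    rewrite big_mkcond /=; apply: leq_sum => t _; case: ifPn => //.
    by rewrite inE => /asboolPn/negP; rewrite -ltnNge => /ltnW.
  by rewrite sum_nat_const card_tuple.
rewrite expnD mulnC (mulnC (#|V| ^ k)) => le.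
have : #|V| ^ h * #|V| ^ k <= #|V| ^ h * (2 * C * #|R|).
  by move: le; move: (#|V| ^ h * #|V| ^ k) => N; rewrite (mulnC (2 * C * #|R|)); lia.
by rewrite leq_pmul2l // expn_gt0 n0.
Qed.

End Supersaturation.

(** * Abundance of gadgets *)

Section GadgetCount.
Variables (k m h q : nat).

(** Inverse densities along the construction: of connecting words into a rich ordered edge, then
    [rich_const] of rich edges, [core_const] of words [u] with rich windows, and [word_const] of
    gadget words before repetitions are excluded. *)
Definition walk_const := 2 * q ^ (h + k).
Definition rich_const := walk_const * k`!.
Definition core_const := 2 * rich_const * (4 * rich_const) ^ m.
Definition word_length := (k + m) + (1 + m.+2 * h).
Definition word_const := core_const * (q * walk_const ^ m.+2).
(** The summands serve [dense_core], [dense_uniq] and [0 < #|V|], in this order. *)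
Definition word_threshold :=
  2 * rich_const + 4 * word_const * (word_length * (k.-1 + word_length)) + 1.

Variables (V : finType) (E : {set {set V}}).
Hypotheses (uE : uniform k E) (k0 : 0 < k) (q0 : 0 < q).
Hypothesis codegree : forall S T : {set V}, #|S| = k.-1 -> #|T| = k.-1 ->
  #|V| <= q * #|ngb E S :&: ngb E T|.

(** Each new letter is a common neighbour of the two current tails, so a single word continues both
    [w1] and [w2]. *)
Lemma dense_walk w1 w2 j : size w1 = k.-1 -> size w2 = k.-1 -> uniq w1 -> uniq w2 ->
  @dense V j (q ^ j) (fun y => all_win k E (w1 ++ y) /\ all_win k E (w2 ++ y)).
Proof.
move=> s1 s2 u1 u2; elim: j => [|j IH].
  by rewrite /dense cnt0 !expn0 mul1n asboolT // !cats0; split; apply: all_win_short; rewrite ?s1 ?s2 ?ltn_predL.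
rewrite -addn1 expnD expn1; apply: dense_cat IH _ => y sy [a1 a2]; apply: dense1.
have cT w : size w = k.-1 -> uniq w -> all_win k E (w ++ y) -> #|tail k (w ++ y)| = k.-1.
  move=> sw uw aw; case: j sy => [/size0nil->|j sy].
    by rewrite cats0 tail_full // cardsE (card_uniqP uw).
  by apply: card_tail aw _ => //; rewrite size_cat sw sy addnS -addSn prednK // leq_addr.
apply: leq_trans (codegree (cT _ s1 u1 a1) (cT _ s2 u2 a2)) _.
rewrite leq_mul2l; apply/orP; right; apply: subset_leq_card; apply/subsetP=> v.
rewrite in_setI inE => /andP[v1 v2]; apply/asboolP; rewrite !catA !cats1.
by split; apply: all_win_rcons; rewrite // size_cat ?s1 ?s2 leq_addr.
Qed.

Lemma dense_ex n C (P : seq V -> Prop) : 0 < #|V| -> dense n C P -> exists2 w, size w = n & P w.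
Proof.
rewrite /dense => V0 dP; have : 0 < cnt n P.
  by rewrite lt0n; apply: contraTneq dP => ->; rewrite muln0 -ltnNge expn_gt0 V0.
by move=> /card_gt0P[t]; rewrite inE => /asboolP Pt; exists t; rewrite ?size_tuple.
Qed.

Lemma card_orderings (f : {set V}) (R : {set k.-tuple V}) : #|f| = k ->
  #|[set t in R | [set x in t] == f]| <= k`!.
Proof.
move=> cf; have <- : size (permutations (enum f)) = k`!.
  by rewrite size_permutations ?enum_uniq // -cardE cf.
rewrite cardE -(size_map val); apply: uniq_leq_size.
  by rewrite map_inj_uniq ?enum_uniq //; exact: val_inj.
move=> w /mapP[t]; rewrite mem_enum inE => /andP[_ /eqP tf] ->.
rewrite mem_permutations; apply: uniq_perm; rewrite ?enum_uniq //.
  by apply/card_uniqP; rewrite -cardsE tf cf size_tuple.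
by move=> x; rewrite mem_enum -tf inE.
Qed.

Variables (a b : V) (A0 : seq V).
Hypotheses (sA : (size A0).+2 = k) (ua : uniq (a :: A0)) (ub : uniq (b :: A0)).

Definition gadget_word (x : seq V) :=
  exists z u Y O, x = gword m z u Y /\ gword_spec k m h E a b z A0 u Y O.

Lemma dense_gadget_word : 0 < h -> word_threshold <= #|V| ->
  dense word_length (2 * word_const) gadget_word.
Proof.
move=> h0 large; have V0 : 0 < #|V| by apply: leq_trans large; rewrite /word_threshold addn1.
pose W y := all_win k E ((a :: A0) ++ y) /\ all_win k E ((b :: A0) ++ y).
have sA1 : (size A0).+1 = k.-1 by rewrite -sA.
have dW : dense (h + k) (q ^ (h + k)) W by apply: dense_walk.
have [cR|] := dense_rich k0 dW; last by move: V0; case: #|V|.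
set R := [set t | _] in cR.
(* The edges with a rich ordering form a dense k-graph, reached by many walks from [a :: A0] and
   from [b :: A0] alike. *)
pose F : {set {set V}} := [set [set x in t] | t : k.-tuple V in R].
have RP (t : k.-tuple V) : t \in R -> dense h walk_const (fun y => W (y ++ t)).
  by rewrite inE => /asboolP.
have FE : F \subset E.
  apply/subsetP=> _ /imsetP[t /RP/(dense_ex V0)[y sy [+ _]] ->].
  move=> /(_ (size ((a :: A0) ++ y) + 0)).
  rewrite catA win_catr win_full ?size_tuple //; apply.
  by rewrite [X in _ <= X]size_cat size_tuple addn0.
have uF : uniform k F by move=> e /(subsetP FE)/uE.
have cF : #|V| ^ k <= rich_const * #|F|.
  apply: leq_trans cR _; rewrite -/walk_const /rich_const -mulnA leq_mul2l; apply/orP; right.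
  rewrite -sum1_card (partition_big (fun t : k.-tuple V => [set x in t]) (mem F)) /=; last first.
    by move=> t tR; apply/imsetP; exists t.
  rewrite mulnC -sum_nat_const; apply: leq_sum => f fF; rewrite sum1dep_card.
  by apply: card_orderings; exact: uF.
have rc0 : 0 < rich_const by rewrite !muln_gt0 expn_gt0 q0 fact_gt0.
have large1 : 2 * rich_const <= #|V|.
  by apply: leq_trans large; rewrite /word_threshold -addnA leq_addr.
have [F' F'F dF'] := dense_core k0 m uF large1 rc0 cF.
(* Fix one rich ordering of every edge of [F], in which the walks enter it. *)
have [O HO] : {O : {set V} -> seq V & forall f, f \in F ->
    [/\ size (O f) = k, [set x in O f] = f & dense h walk_const (fun y => W (y ++ O f))]}.
  apply: (@choice _ _ (fun f (o : seq V) => f \in F ->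
    [/\ size o = k, [set x in o] = f & dense h walk_const (fun y => W (y ++ o))])) => f.
  have [/imsetP[t tR ft]|nf] := boolP (f \in F); last by exists [::].
  by exists t; split; [rewrite size_tuple | | exact: RP].
have cb : #|[set v in b :: A0]| = k.-1 by rewrite cardsE (card_uniqP ub).
(* The last walk [Y m.+1], used from [b :: A0], leads to window 0 of [u], as [Y 0] does. *)
pose ix i := if i == m.+1 then 0 else i.
pose pre x := exists z u Y, x = gword m z u Y /\
  [/\ size u = k + m, all_win k F' u, z \in ngb E [set v in b :: A0] &
      forall i, i < m.+2 -> size (Y i) = h /\ W (Y i ++ O (win k u (ix i)))].
have dpre : dense word_length word_const pre.
  apply: dense_cat dF' _ => u su au; apply: (dense_cat (P := fun s => exists2 z, s = [:: z] & z \in ngb E [set v in b :: A0])).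
    apply: dense1; apply: leq_trans (codegree cb cb) _; rewrite setIid leq_mul2l.
    apply/orP; right; apply: subset_leq_card; apply/subsetP=> v vN; rewrite inE.
    by apply/asboolP; exists v.
  move=> s _ [z -> zN].
  apply: dense_weaken (dense_flatten (n := m.+2) (Q := fun i y => W (y ++ O (win k u (ix i)))) _) => [//|w _ [Y [-> HY]]|i im].
    by exists z, u, Y.
  have : win k u (ix i) \in F.
    apply: (subsetP F'F); apply: au; rewrite su addnC leq_add2l /ix.
    by case: eqVneq => // ne; rewrite -ltnS ltn_neqAle ne.
  by move=> /HO[].
have s1 : size (a :: A0) = k.-1 by rewrite /= sA1.
have s2 : size (b :: A0) = k.-1 by rewrite /= sA1.
have large2 : 4 * word_const * (word_length * (k.-1 + word_length)) <= #|V|.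
  by apply: leq_trans large; rewrite /word_threshold -addnA addnCA leq_addr.
(* Only here are repeated vertices excluded, at the cost of a factor 2. *)
apply: dense_weaken (dense_uniq ua ub s1 s2 large2 V0 dpre) => // x _.
case=> [[z [u [Y [-> [su au zN HY]]]]] [u1 u2]].
have winF i : i <= m -> win k u i \in F.
  by move=> im; apply: (subsetP F'F); apply: au; rewrite su addnC leq_add2l.
exists z, u, Y, (fun i => O (win k u (ix i))); split=> //; split=> //.
- move=> i im; have [sY _] := HY i im; split=> //.
  have [|-> //] := HO (win k u (ix i)); apply: winF; rewrite /ix.
  by case: eqVneq => // ne; rewrite -ltnS ltn_neqAle ne.
- move=> i im; have ixi : ix i = i by rewrite /ix ltn_eqF.
  have [_ [a1 _]] := HY i (leqW im); have [_ e1 _] := HO _ (winF i im).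
  by rewrite /spath ixi e1; split=> //; rewrite ixi in a1.
- have ixm : ix m.+1 = 0 by rewrite /ix eqxx.
  have [_ [_ a2]] := HY m.+1 (ltnSn _); have [_ e0 _] := HO _ (winF 0 (leq0n m)); rewrite /tpath ixm in a2 *.
  split=> // i; case: i => [_|i]; last by rewrite win_cons /= addSn ltnS; exact: a2.
  move: zN; rewrite inE; congr (_ \in E).
  rewrite /win drop0 -!cat_cons take_size_cat //.
  by apply/setP=> v; rewrite !inE.
Qed.

End GadgetCount.

(** * Upper bound *)

Section Footprints.
Variables (k N : nat) (V : finType).
Hypotheses (k0 : 0 < k) (N0 : 0 < N).
Implicit Types (S f : {set V}) (x : seq V).

(* All k-sets are listed, not only the edges of the gadget: when the gadgets at [S] have
   disjoint footprints, a given edge containing [S] is unusable for at most one of them. *)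
Definition foot S x : {set {set V}} :=
  [set f : {set V} | (#|f| == k) && ((f \subset S :|: [set v in x]) || (f \subset nx S :|: [set v in x]))].

Lemma card_foot S x : #|S| = k.-1 -> size x = N -> #|foot S x| <= 2 * 2 ^ (k.-1 + N).
Proof.
move=> cS sx.
have le (T : {set V}) : #|T| = k.-1 -> #|powerset (T :|: [set v in x])| <= 2 ^ (k.-1 + N).
  move=> cT; rewrite card_powerset leq_exp2l //.
  by apply: leq_trans (leq_card_setU _ _) _; rewrite cT leq_add2l cardsE -sx card_size.
apply: leq_trans (_ : #|powerset (S :|: [set v in x]) :|: powerset (nx S :|: [set v in x])| <= _).
  apply: subset_leq_card; apply/subsetP=> f.
  by rewrite in_setU !powersetE inE => /andP[_].
apply: leq_trans (leq_card_setU _ _) _; rewrite mul2n -addnn leq_add // le ?card_nx //.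
Qed.

(** [S] and [y] together form a word of [k.-1 + N] letters covering [f]. By [cnt_cover] this saves
    [k] letters, one more than [S] has, hence the exponent [N.-1]. *)
Lemma sum_cnt_subset f : #|f| = k -> 0 < #|V| ->
  \sum_(S : {set V} | #|S| == k.-1) cnt N (fun y => f \subset S :|: [set v in y])
    <= (k.-1 + N) ^ k * #|V| ^ N.-1.
Proof.
move=> cf V0; apply: leq_trans (_ : cnt (k.-1 + N) (fun w => f \subset w) <= _).
  apply: leq_trans (cnt_set_sum _ _ _); apply: leq_sum => S _; apply: cnt_le => y _.
  move=> /subsetP h; apply/subsetP => v /h.
  by rewrite !inE mem_cat mem_enum.
have := cnt_cover (k.-1 + N) f; rewrite cf.
have -> : k.-1 + N = k + N.-1 by rewrite -[k in RHS]prednK // -[N in LHS]prednK // addSnnS.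
rewrite expnD (mulnC (#|V| ^ k)) mulnA leq_pmul2r // expn_gt0 V0 //.
Qed.

(** At most [k] sets [S] share the same [nx S], so the second alternative in [foot] adds at most [k]
    times the bound for the first. *)
Lemma sum_cnt_foot f : 0 < #|V| ->
  \sum_(S : {set V} | #|S| == k.-1) cnt N (fun y => f \in foot S y)
    <= k.+1 * ((k.-1 + N) ^ k * #|V| ^ N.-1).
Proof.
move=> V0; have [cf|ncf] := eqVneq #|f| k; last first.
  rewrite big1 // => S _; apply/eqP; rewrite cards_eq0; apply/eqP/setP=> t.
  by rewrite !inE (negPf ncf) asboolb.
apply: leq_trans (_ : \sum_(S : {set V} | #|S| == k.-1)
   (cnt N (fun y => f \subset S :|: [set v in y]) +
    cnt N (fun y => f \subset nx S :|: [set v in y])) <= _).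
  apply: leq_sum => S _; apply: leq_trans (cntU _ _ _); apply: cnt_le => y _.
  by rewrite inE => /andP[_ /orP].
rewrite big_split mulSn leq_add ?sum_cnt_subset //.
rewrite (partition_big (@nx V) (fun T => #|T| == k.-1)) /=; last by move=> S; rewrite card_nx.
apply: leq_trans (_ : \sum_(T : {set V} | #|T| == k.-1)
   k * cnt N (fun y => f \subset T :|: [set v in y]) <= _); last first.
  by rewrite -big_distrr /= leq_mul2l sum_cnt_subset ?orbT.
apply: leq_sum => T cT.
rewrite (eq_bigr (fun=> cnt N (fun y => f \subset T :|: [set v in y]))); last by move=> S /andP[_ /eqP->].
rewrite sum_nat_cond_const leq_mul2r; apply/orP; right.
apply: leq_trans (_ : #|[set S | nx S == T]| <= _).
  by apply: subset_leq_card; apply/subsetP=> S; rewrite !inE => /andP[].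
by have := card_nx_fiber T; rewrite (eqP cT) prednK.
Qed.

End Footprints.

(** * Reserving gadgets, packing paths and absorbing the rest *)

Section Assembly.
Variables (k m q : nat).
Hypotheses (k2 : 2 <= k) (m0 : 0 < m) (q0 : 0 < q).

(** [h] is chosen to make [k + h] a multiple of [m]. [R] is twice the number of tokens a set can
    hold, [Kc] bounds the size of a footprint, and [Dc * #|V| ^ N.-1] the number of choices of [S],
    [r] and a word whose footprint contains a given k-set. *)
Let h := m * k.+1 - k.
Let N := word_length k m h.
Let R := 2 * (m + k.-1 + m * k).
Let C := 2 * word_const k m h q.
Let Kc := 2 * 2 ^ (k.-1 + N).
Let Dc := R * (k.+1 * (k.-1 + N) ^ k).

Definition size_threshold := word_threshold k m h q + C * (4 * (Kc * Dc)) + C + 1.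

Let k0 : 0 < k. Proof. exact: ltnW. Qed.
Let hk : k + h = k.+1 * m.
Proof. by rewrite /h subnKC; [rewrite mulnC | rewrite -[X in X <= _]mul1n leq_mul]. Qed.
Let h0 : 0 < h.
Proof. by rewrite subn_gt0; apply: leq_trans (ltnSn k) _; rewrite -[X in X <= _]mul1n leq_mul ?leqnSn. Qed.
Let N0 : 0 < N. Proof. by rewrite /N /word_length -addnA addn_gt0 k0. Qed.

Variables (V : finType) (E : {set {set V}}).
Implicit Types S : {set V}.
Hypotheses (uE : uniform k E) (large : size_threshold <= #|V|).
Hypothesis codegree : forall S T : {set V}, #|S| = k.-1 -> #|T| = k.-1 ->
  #|V| <= q * #|ngb E S :&: ngb E T|.

Let V0 : 0 < #|V|. Proof. by apply: leq_trans large; rewrite /size_threshold addn1. Qed.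

Let goodw (S : {set V}) (x : seq V) := exists K A g,
  gadget k m S (nx S) (foot k S x) K A g /\ K :|: A \subset E.

Let dense_good (S : {set V}) : #|S| = k.-1 -> dense N C (goodw S).
Proof.
move=> cS; have S0 : S != set0 by rewrite -card_gt0 cS -ltnS prednK.
have [a [b [aS bS nS]]] := nxP S0.
have cA : #|S :\ a|.+1 = k.-1 by rewrite -cS (cardsD1 a S) aS.
have sA : (size (enum (S :\ a))).+2 = k by rewrite -cardE cA prednK.
have ua : uniq (a :: enum (S :\ a)) by rewrite /= enum_uniq mem_enum !inE eqxx.
have ub : uniq (b :: enum (S :\ a)) by rewrite /= enum_uniq mem_enum bS.
have large' : word_threshold k m h q <= #|V|.
  by apply: leq_trans large; rewrite /size_threshold; do 2!(apply: leq_trans (leq_addr _ _)); exact: leq_addr.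
apply: dense_weaken (dense_gadget_word uE k0 q0 codegree sA ua ub h0 large') => // x _.
case=> [z [u [Y [O [-> spec]]]]].
have mkh : m %| k + h by rewrite hk dvdn_mull.
have [K [A [g [gad KA]]]] := gword_gadget h0 mkh sA spec.
exists K, A, g; split=> //.
have eS c : [set v in c :: enum (S :\ a)] = c |: (S :\ a).
  by apply/setP=> v; rewrite in_set in_cons mem_enum in_setU1.
have <- : footprint k m a b z (enum (S :\ a)) u Y = foot k S (gword m z u Y).
  apply/setP=> f; rewrite !in_set nS; congr (_ && (_ || _)); apply: eq_subset_r => v.
    rewrite -cat_cons mem_cat in_setU in_set -[in RHS](setD1K aS) -eS in_set //.
  by rewrite -cat_cons mem_cat in_setU in_set -eS in_set.
by rewrite -[S in gadget _ _ S](setD1K aS) nS -!eS.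
Qed.

Let P : finType := ({set V} * 'I_R)%type.
(** The index type [P] contains sets of every size; those of size other than [k.-1] accept all words
    and conflict with nothing. *)
Let X (p : P) : {set N.-tuple V} := [set t : N.-tuple V | `[< #|p.1| = k.-1 -> goodw p.1 t >]].
Let cf (p : P) (x : N.-tuple V) (p' : P) (y : N.-tuple V) :=
  [&& #|p.1| == k.-1, #|p'.1| == k.-1 & ~~ [disjoint foot k p.1 x & foot k p'.1 y]].

(** A footprint has at most [Kc] members, each lying in the footprints of at most [Dc * #|V| ^ N.-1]
    choices. This is one power of [#|V|] below the number of good words at each index, so the
    transversal lemma applies. *)
Let choice_of_words : exists f : P -> N.-tuple V,
  (forall p, f p \in X p) /\ forall p p', p != p' -> ~~ cf p (f p) p' (f p').
Proof.
pose D := Kc * (Dc * #|V| ^ N.-1).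
have C0 : 0 < C.
  by rewrite /C /word_const /core_const /rich_const /walk_const !(muln_gt0, expn_gt0, fact_gt0, q0).
apply: (@transversal_exists _ _ X cf (#|V| ^ N %/ C) D).
- by move=> p x p' y; rewrite /cf disjoint_sym andbCA.
- move=> p; have [cp|ncp] := eqVneq #|p.1| k.-1.
    apply: leq_trans (_ : cnt N (goodw p.1) <= _).
      by rewrite -(leq_pmul2r C0); apply: leq_trans (leq_trunc_div _ _) _; rewrite mulnC; exact: dense_good.
    by apply: subset_leq_card; apply/subsetP=> t; rewrite !inE => /asboolP g; apply/asboolP.
  rewrite (_ : X p = setT); first by rewrite cardsT card_tuple leq_div.
  by apply/setP=> t; rewrite !inE; apply/asboolP => cp; rewrite cp eqxx in ncp.
- move=> [S r] x _ /=; rewrite /cf /=; have [cS|_] := eqVneq #|S| k.-1; last first.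
    by rewrite big1 // => p _; apply/eqP; rewrite cards_eq0; apply/eqP/setP=> y; rewrite !inE andbF.
  apply: leq_trans (_ : \sum_(p : P | #|p.1| == k.-1)
     \sum_(f in foot k S x) cnt N (fun y => f \in foot k p.1 y) <= _).
    rewrite big_mkcond [leqRHS]big_mkcond; apply: leq_sum => p _.
    case: ifP => // _; case: ifP => [cp|_]; last first.
      by rewrite leqn0 cards_eq0; apply/eqP/setP=> y; rewrite !inE andbF.
    apply: leq_trans (card_bigcup_le (mem (foot k S x)) (fun f => [set y : N.-tuple V | `[< f \in foot k p.1 y >]])).
    apply: subset_leq_card; apply/subsetP=> y; rewrite inE => /andP[_ /=].
    rewrite -setI_eq0 => /set0Pn[f]; rewrite in_setI => /andP[f1 f2].
    by apply/bigcupP; exists f => //; rewrite inE; apply/asboolP.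
  rewrite exchange_big /=.
  apply: leq_trans (_ : \sum_(f in foot k S x) Dc * #|V| ^ N.-1 <= _); last first.
    by rewrite sum_nat_const leq_mul2r card_foot ?orbT // size_tuple.
  apply: leq_sum => f _.
  rewrite (_ : \sum_(p : P | _) _ = \sum_(S' : {set V} | #|S'| == k.-1) \sum_(r' : 'I_R)
      cnt N (fun y => f \in foot k S' y)); last first.
    by rewrite pair_big; apply: eq_bigl => p; rewrite andbT.
  under eq_bigr do rewrite sum_nat_const card_ord.
  by rewrite -big_distrr /= /Dc -(mulnA R) leq_mul2l -(mulnA k.+1) sum_cnt_foot ?orbT.
- rewrite divn_gt0 //; apply: leq_trans (_ : #|V| <= _).
    by apply: leq_trans large; rewrite /size_threshold addn1 ltnW // ltnS leq_addl.
  by rewrite -[X in X <= _]expn1 leq_pexp2l.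
- rewrite leq_divRL // -[in _ ^ N](prednK N0) expnS /D.
  apply: leq_trans (_ : C * (4 * (Kc * Dc)) * #|V| ^ N.-1 <= _); first by lia.
  by rewrite leq_mul2r; apply/orP; right; apply: leq_trans large; rewrite /size_threshold; lia.
Qed.

Theorem dec_of_codegree : m %| #|E| -> dec k m E.
Proof.
move=> mE; have [w [wX wcf]] := choice_of_words.
have [G HG] : {G : P -> {set {set V}} * {set {set V}} * {set V} &
    forall p : P, #|p.1| = k.-1 ->
      gadget k m p.1 (nx p.1) (foot k p.1 (w p)) (G p).1.1 (G p).1.2 (G p).2 /\
      (G p).1.1 :|: (G p).1.2 \subset E}.
  apply: (@choice _ _ (fun (p : P) (G : {set {set V}} * {set {set V}} * {set V}) => #|p.1| = k.-1 ->
      gadget k m p.1 (nx p.1) (foot k p.1 (w p)) G.1.1 G.1.2 G.2 /\ G.1.1 :|: G.1.2 \subset E)) => p.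
  have [cp|ncp] := eqVneq #|p.1| k.-1; last by exists (set0, set0, set0) => cp; rewrite cp eqxx in ncp.
  have := wX p; rewrite inE => /asboolP/(_ cp)[K [A [g HKA]]].
  by exists (K, A, g).
pose K (S : {set V}) (r : 'I_R) := (G (S, r)).1.1.
pose A (S : {set V}) (r : 'I_R) := (G (S, r)).1.2.
pose g (S : {set V}) (r : 'I_R) := (G (S, r)).2.
pose fp (S : {set V}) (r : 'I_R) := foot k S (w (S, r)).
have gadgets (S : {set V}) r : #|S| = k.-1 -> is_gadget k m K A fp g S r.
  by move=> cS; have [] := HG (S, r) cS.
have fpc (S : {set V}) (r : 'I_R) x : #|S| = k.-1 -> x \in fp S r -> #|x| = k.
  by rewrite inE => _ /andP[/eqP].
have fpd (S : {set V}) (r : 'I_R) (S' : {set V}) (r' : 'I_R) : #|S| = k.-1 -> #|S'| = k.-1 ->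
    (S, r) != (S', r') -> [disjoint fp S r & fp S' r'].
  by move=> cS cS' /wcf; rewrite /cf cS cS' eqxx /= negbK.
pose Z : {set {set V}} := [set S : {set V} | #|S| == k.-1].
(* All reserved edges; the packing takes place outside them. *)
pose U := \bigcup_(S in Z) \bigcup_(r in [set: 'I_R]) gad K A S r.
have ZP (S : {set V}) : S \in Z -> #|S| = k.-1 by rewrite inE => /eqP.
have UE : U \subset E.
  apply/bigcupsP => S /ZP cS; apply/bigcupsP => r _.
  by have [_] := HG (S, r) cS.
have dU : dec k m U.
  apply: dec_bigcup_in => [S /ZP cS|S S' /ZP cS /ZP cS' ne]; first exact: dec_gads gadgets fpd _ _ cS.
  apply/disjoint_setP => e /bigcupP[r _ er]; apply/negP => /bigcupP[r' _]; apply/negP.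
  apply/disjoint_setP: e er; apply: (gad_disjoint gadgets fpd) => //.
  by apply: contra ne => /eqP[->].
have uD : uniform k (E :\: U) by move=> e /setDP[/uE].
have [L [al [LE dL alL fib]]] := sparse_leftover m0 k0 uD.
(* [E] consists of [U], the packed paths and [L], and the first two have a multiple of [m] edges. *)
have mL : m %| #|L|.
  have c1 := cardsID U E; rewrite (setIidPr UE) in c1.
  have c2 := cardsID L (E :\: U); rewrite (setIidPr LE) in c2.
  have m1 := dec_dvd k0 dU; have m2 := dec_dvd k0 dL.
  by move: mE; rewrite -c1 -c2 (dvdn_addr _ m1) (dvdn_addl _ m2).
have LU : [disjoint L & U].
  by rewrite disjoints_subset; apply: subset_trans LE _; rewrite setDE subsetIr.
have gadU (S : {set V}) r : S \in Z -> gad K A S r \subset U.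
  by move=> SZ; rewrite /U (bigcup_max S) // (bigcup_max r).
have dLU : dec k m (L :|: U).
  apply: (absorb (t := m + k.-1) k0 m0 gadgets fpc fpd (leqnn R) (alpha := al)) => //.
  - by move=> S /ZP cS; rewrite inE card_nx cS eqxx.
  - by move=> y yL; have [ay cy] := alL y yL; split; rewrite ?inE ?cy //; apply: uD; exact: (subsetP LE).
  - by move=> S _; apply: leq_trans (fib S) _; exact: leq_addr.
  - by move=> S r SZ; apply: disjointWr LU; exact: gadU.
have -> : E = (E :\: U :\: L) :|: (L :|: U).
  apply/setP=> e; have := subsetP UE e; have := subsetP LE e; rewrite !(in_setU, in_setD).
  move: (e \in U) (e \in L) (e \in E) => [] [] [] //=; first [by move=> _ /(_ isT) | by move=> /(_ isT)].
apply: dec_disjU => //; apply/disjoint_setP => e; rewrite !(in_setU, in_setD) negb_or.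
by case/and3P=> -> ->.
Qed.

End Assembly.

(** * Windows and copies of the tight path *)

Section Copies.
Variables (k l : nat).
Hypotheses (k0 : 0 < k) (kl : k <= l).
Let m := l - k + 1.

Let lE : m + k.-1 = l. Proof. by rewrite /m; lia. Qed.

Lemma imset_tight_path (V : finType) (f : 'I_l -> V) :
  [set f @: e | e : {set 'I_l} in tight_path k l] = wins k [seq f i | i <- enum 'I_l] 0 m.
Proof.
have wE i : i < m -> f @: [set v : 'I_l | i <= v < i + k] = win k [seq f i | i <- enum 'I_l] i.
  move=> im; have l0 : 0 < l by lia.
  pose i0 := Ordinal l0; have sz : size [seq f i | i <- enum 'I_l] = l by rewrite size_map size_enum_ord.
  apply/setP=> x; apply/imsetP/idP => [[v]|/(winP (f i0))[j [hj jl ->]]].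
    rewrite inE => hv ->; have -> : f v = nth (f i0) [seq f i | i <- enum 'I_l] v.
      by rewrite (nth_map i0) ?size_enum_ord // nth_ord_enum.
    by apply: mem_win; rewrite ?sz.
  rewrite sz in jl; exists (Ordinal jl); first by rewrite inE.
  by rewrite (nth_map i0) ?size_enum_ord // (nth_ord_enum i0 (Ordinal jl)).
apply/setP=> e; apply/imsetP/winsP => [[_ /imsetP[i _ ->] ->]|[i /andP[_ im] ->]].
  by exists i; [exact: ltn_ord | apply: wE; exact: ltn_ord].
exists [set v : 'I_l | i <= v < i + k]; last by rewrite wE.
by apply/imsetP; exists (Ordinal im).
Qed.

Lemma card_tight_path : #|tight_path k l| = m.
Proof.
rewrite -(card_imset _ (imset_inj (@inj_id 'I_l))) imset_tight_path map_id.
by rewrite card_wins ?enum_uniq // size_enum_ord; lia.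
Qed.

(** Every vertex of the path lies in some window, so [cover B] is its vertex set. *)
Lemma path_edges_copy (V : finType) (B : {set {set V}}) :
  path_edges k m B -> is_copy (tight_path k l) (cover B, B).
Proof.
case=> w uw [sw ->]; have l0 : 0 < l by lia.
have v0 : V by case: (w) sw => [|v ?] //=; lia.
rewrite lE in sw.
have fE : [seq nth v0 w (i : 'I_l) | i <- enum 'I_l] = w.
  by rewrite -[RHS](mkseq_nth v0) /mkseq sw -val_enum_ord -map_comp.
exists (fun i : 'I_l => nth v0 w i); split.
- by move=> i j /eqP; rewrite nth_uniq ?sw // => /eqP/val_inj.
- apply/setP=> v; apply/imsetP/bigcupP => [[i _ ->]|[e /winsP[j _ ->] /(winP v0)[i [_ il ->]]]].
    (* Vertex [i] begins window [i] or, near the end of the path, lies in the last window,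
       [l - k]. *)
    exists (win k w (minn i (l - k))).
      by apply/winsP; exists (minn i (l - k)) => //; rewrite /m; lia.
    have := ltn_ord i => il; apply: mem_win; rewrite ?sw //; lia.
  by rewrite sw in il; exists (Ordinal il).
- by rewrite imset_tight_path fE.
Qed.

Lemma copy_path_edges (V : finType) (G : part_graph V) :
  is_copy (tight_path k l) G -> path_edges k m G.2.
Proof.
case=> f [inj_f _ <-]; exists [seq f i | i <- enum 'I_l].
  by rewrite map_inj_uniq ?enum_uniq.
by rewrite size_map size_enum_ord imset_tight_path.
Qed.

Lemma dec_decomposition (V : finType) (E : {set {set V}}) :
  dec k m E -> exists D : {set part_graph V}, decomposition (tight_path k l) E D.
Proof.
move=> dE.
suff [D [h1 h2]] : exists D : {set part_graph V},
    (forall G, G \in D -> [/\ G.1 = cover G.2, G.2 \subset E & is_copy (tight_path k l) G]) /\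
    forall e, e \in E -> #|[set G in D | e \in G.2]| = 1.
  exists D; split=> // G /h1[c s cp]; split=> //; split=> // e eG; rewrite c.
  exact: bigcup_max eG _.
elim: dE => [|B X pB dBX _ [D [h1 h2]]].
  by exists set0; split=> [G|e]; rewrite inE.
exists ((cover B, B) |: D); split.
  move=> G /setU1P[->|/h1[c s cp]]; last by split=> //; apply: subset_trans s (subsetUr _ _).
  by split=> //=; [exact: subsetUl | exact: path_edges_copy].
move=> e; rewrite in_setU; have [eB _|eB /= eX] := boolP (e \in B).
  rewrite (_ : [set _ in _ | _] = [set (cover B, B)]) ?cards1 //.
  apply/setP=> G; rewrite !inE; apply/andP/eqP => [[/orP[/eqP-> //|/h1[_ s _] eG]]|->]; last by rewrite eqxx.
  by have := disjointFr dBX eB; rewrite (subsetP s).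
rewrite -(h2 e eX); apply: eq_card => G; rewrite !inE.
by case: eqP => [->|//]; rewrite /= (negPf eB) andbF.
Qed.

End Copies.

Lemma big_minn_le (I : finType) (P : pred I) (F : I -> nat) x j : P j ->
  \big[minn/x]_(i | P i) F i <= F j.
Proof.
move=> Pj; rewrite unlock; have : j \in index_enum I by rewrite mem_index_enum.
elim: (index_enum I) => //= i r IH; rewrite inE => /orP[/eqP<-|/IH h].
  by rewrite Pj geq_minl.
by case: (P i) => //; apply: leq_trans h; rewrite geq_minr.
Qed.

Lemma le_big_minn (I : finType) (P : pred I) (F : I -> nat) x b : b <= x ->
  (forall i, P i -> b <= F i) -> b <= \big[minn/x]_(i | P i) F i.
Proof.
by move=> bx bF; elim/big_ind: _ => // y z by_ bz; rewrite leq_min by_.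
Qed.

Import Order.TTheory GRing.Theory Num.Theory.

(** * The threshold is at most one half *)

Section Reals.
Local Open Scope ring_scope.

Lemma half_forces_decomposition (R : realType) (k l : nat) :
  (2 <= k)%N -> (k <= l)%N -> forces_decomposition k l (2^-1 : R).
Proof.
move=> k2 kl eps eps0; have k0 : (0 < k)%N by exact: ltnW.
(* Two neighbourhoods of relative size at least [1/2 + eps] share a proportion of at least [2 * eps]
   of the vertices, hence at least [1 / q]. *)
pose q := Num.bound (eps^-1); have q_eps : 1 <= q%:R * eps.
  have : eps^-1 < q%:R by apply: archi_boundP; rewrite invr_ge0 ltW.
  by rewrite -(ltr_pM2r eps0) mulVf ?gt_eqF // => /ltW.
have q0 : (0 < q)%N.
  by rewrite lt0n; apply: contraTneq q_eps => ->; rewrite mul0r ler10.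
exists (size_threshold k (l - k + 1) q) => V E uE large dvdE degE.
apply: dec_decomposition => //; apply: (dec_of_codegree (q := q)) => //.
- by rewrite addn1.
- move=> S T cS cT; rewrite -(ler_nat R) natrM.
  have deg_lb (U : {set V}) : #|U| = k.-1 -> (2^-1 + eps) * #|V|%:R <= (#|ngb E U|)%:R :> R.
    move=> cU; apply: le_trans degE _; rewrite ler_nat (card_ngb k0 uE cU).
    by apply: big_minn_le; rewrite cU.
  have dS := deg_lb S cS; have dT := deg_lb T cT.
  have cap : (#|ngb E S| + #|ngb E T|)%:R <= (#|ngb E S :&: ngb E T| + #|V|)%:R :> R.
    by rewrite ler_nat -cardsUI addnC leq_add2l max_card.
  rewrite !natrD in cap.
  have c2 : eps * #|V|%:R <= #|ngb E S :&: ngb E T|%:R.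
    have n0 : 0 <= eps * #|V|%:R by rewrite mulr_ge0 ?ler0n ?(ltW eps0).
    by move: dS dT; rewrite mulrDl; lra.
  apply: le_trans (_ : q%:R * (eps * #|V|%:R) <= _); last by rewrite ler_wpM2l.
  by rewrite mulrA -[X in X <= _]mul1r ler_wpM2r.
- by move: dvdE; rewrite /path_divisible card_tight_path.
Qed.

End Reals.

(** * Lower bound *)

Section TwoClasses.
Variables (k m : nat) (V : finType) (H : {set V}).
Hypotheses (k2 : 2 <= k).
Implicit Types (e S : {set V}) (A E : {set {set V}}).

Let k0 : 0 < k. Proof. exact: ltnW. Qed.

Definition even_edges : {set {set V}} := [set e : {set V} | (#|e| == k) && ~~ odd #|e :&: H|].

Lemma even_edges_uniform : uniform k even_edges.
Proof. by move=> e; rewrite inE => /andP[/eqP]. Qed.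

(** All but at most one vertex of [e'] lie in [e], so [e'] meets [H] at most once, and by parity not
    at all. *)
Lemma even_edges_avoid e e' v : e' \in even_edges -> e' \subset v |: e ->
  e :&: H = set0 -> e' :&: H = set0.
Proof.
rewrite inE => /andP[_ odd'] sub e0; apply/eqP; rewrite -cards_eq0.
have : #|e' :&: H| <= 1.
  rewrite -(cards1 v); apply: subset_leq_card; apply/subsetP=> x.
  rewrite in_setI => /andP[/(subsetP sub)]; rewrite in_setU1 => /orP[xv _|xe xH]; first by rewrite in_set1.
  by have/setP/(_ x) := e0; rewrite in_setI in_set0 xe xH.
by move: odd'; case: #|_| => [|[|]].
Qed.

Lemma win_succ (w : seq V) v0 i :
  win k w i.+1 \subset nth v0 w (i + k) |: win k w i /\
  win k w i \subset nth v0 w i |: win k w i.+1.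
Proof.
split; apply/subsetP=> x /(winP v0)[j [hj jw ->]]; rewrite in_setU1.
  case: (ltnP j (i + k)) => h; first by rewrite mem_win ?orbT //; lia.
  by rewrite (_ : j = i + k) ?eqxx //; lia.
have [->|ne] := eqVneq j i; first by rewrite eqxx.
by rewrite mem_win ?orbT //; lia.
Qed.

Lemma path_class w c : all_win k even_edges w -> c + k <= (size w).+1 ->
  (forall i, i < c -> win k w i :&: H = set0) \/
  (forall i, i < c -> win k w i :&: H <> set0).
Proof.
move=> aw; elim: c => [|c IH] hc; first by left.
case: c IH hc => [_ _|c IH hc].
  by have [h|h] := eqVneq (win k w 0 :&: H) set0; [left | right] => -[] // _; apply/eqP.
have v0 : V by case: (w) hc => [|v ?] //=; lia.
have [s1 s2] := win_succ w v0 c.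
have w1 : win k w c.+1 \in even_edges by apply: aw; lia.
have w2 : win k w c \in even_edges by apply: aw; lia.
have [|h|h] := IH; first by lia.
  left=> i; rewrite ltnS leq_eqVlt => /orP[/eqP->|]; last exact: h.
  by apply: even_edges_avoid w1 s1 _; exact: h.
right=> i; rewrite ltnS leq_eqVlt => /orP[/eqP->|]; last exact: h.
by move=> e0; apply: (h c (ltnSn _)); apply: even_edges_avoid w2 s2 e0.
Qed.

(** The parity of [#|S :&: H|] decides which half completes [S] to an edge; only the vertices of [S]
    itself are excluded from it. *)
Lemma codegree_even_edges S N : #|H| = N -> #|~: H| = N -> #|S| = k.-1 ->
  N - k <= degree even_edges S.
Proof.
move=> cH cH' cS; rewrite -(card_ngb k0 even_edges_uniform cS).
pose T := if odd #|S :&: H| then H else ~: H.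
have cT : #|T| = N by rewrite /T; case: ifP.
apply: leq_trans (_ : #|T :\: S| <= _).
  have := cardsD T S; have := subset_leq_card (subsetIr T S); lia.
apply: subset_leq_card; apply/subsetP=> v /setDP[vT vS]; rewrite !inE.
rewrite cardsU1 vS cS add1n prednK // eqxx /= setIUl.
move: vT; rewrite /T; case: ifPn => oS.
  move=> vH; rewrite (_ : [set v] :&: H = [set v]); last by apply/setIidPl; rewrite sub1set.
  by rewrite cardsU1 inE (negPf vS) add1n /= oS.
rewrite inE => vH; rewrite (_ : [set v] :&: H = set0) ?set0U //.
by apply/setP=> x; rewrite !inE; case: eqP => // ->; rewrite (negPf vH).
Qed.

End TwoClasses.

Lemma trim_card (T : finType) (A : {set T}) m r : 0 < m -> r < m -> m <= #|A| ->
  exists A' : {set T}, [/\ A' \subset A, #|A'| = r %[mod m] & #|A :\: A'| < m].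
Proof.
move=> m0 rm mA; pose c := (#|A| - r) %% m.
have cm : c < m by rewrite ltn_mod.
pose C := [set x in take c (enum A)].
have CA : C \subset A by apply/subsetP=> x; rewrite inE => /mem_take; rewrite mem_enum.
have cC : #|C| = c.
  rewrite cardsE (card_uniqP (take_uniq _ (enum_uniq _))) size_takel // -cardE.
  by apply: leq_trans mA; exact: ltnW.
exists (A :\: C); split; [exact: subsetDl | | by rewrite setDDr setDv set0U (setIidPr CA) cC].
rewrite cardsD (setIidPr CA) cC.
have e := divn_eq (#|A| - r) m; rewrite -/c in e.
have -> : #|A| - c = (#|A| - r) %/ m * m + r.
  have := leq_trans (ltnW rm) mA; move: e; move: ((#|A| - r) %/ m * m) => x; clear; lia.
by rewrite modnMDl.
Qed.

(** By [path_class] a path has all or none of its edges in [A], so it contributes [l - k + 1] or 0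
    to [#|A|]. *)
Lemma no_decomposition k l (V : finType) (H : {set V}) (A E : {set {set V}}) (D : {set part_graph V}) :
  2 <= k -> k <= l -> E \subset even_edges k H ->
  A = [set e in E | e :&: H == set0] ->
  decomposition (tight_path k l) E D -> l - k + 1 %| #|A|.
Proof.
move=> k2 kl EH AE [h1 h2]; have k0 : 0 < k by exact: ltnW.
have -> : #|A| = \sum_(G in D) #|A :&: G.2|.
  rewrite -sum1_card (eq_bigr (fun e => \sum_(G in D) (e \in G.2 : nat))); last first.
    move=> e eA; have eE : e \in E by move: eA; rewrite AE inE => /andP[].
    by rewrite -(h2 e eE) -sum1dep_card big_mkcondr.
  rewrite exchange_big /=; apply: eq_bigr => G _.
  by rewrite -big_mkcondr -sum1_card; apply: eq_bigl => e; rewrite in_setI.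
elim/big_rec: _ => [|G x GD dx]; first exact: dvdn0.
rewrite dvdn_addl //.
have [[GE _] cp] := h1 G GD; have [w uw [sw G2]] := copy_path_edges k0 kl cp.
have cG : #|G.2| = l - k + 1 by rewrite G2 card_wins // sw; lia.
have aw : all_win k (even_edges k H) w.
  move=> i; rewrite sw => hi; apply: (subsetP EH); apply: (subsetP GE); rewrite G2.
  by apply/winsP; exists i => //; lia.
have [|h|h] := path_class k2 (c := l - k + 1) aw; first by rewrite sw; lia.
  have GA : G.2 \subset A.
    apply/subsetP=> e eG; rewrite AE inE (subsetP GE) //=.
    by move: eG; rewrite G2 => /winsP[i /andP[_ hi] ->]; rewrite h.
  by rewrite (setIidPr GA) cG.
rewrite (_ : A :&: G.2 = set0) ?cards0 //; apply/setP=> e; rewrite !inE AE inE.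
apply/negP => /andP[/andP[_ /eqP e0]]; rewrite G2 => /winsP[i /andP[_ hi] ei].
by apply: (h i hi); rewrite -ei.
Qed.

Lemma two_class_hypergraph k l N : 2 <= k -> k < l -> 2 * k + 4 * l <= N ->
  exists E : {set {set bool * 'I_N}},
  [/\ uniform k E, path_divisible k l E, N - (k + 2 * l) <= min_degree k.-1 E &
      forall D : {set part_graph (bool * 'I_N)%type}, ~ decomposition (tight_path k l) E D].
Proof.
move=> k2 kl Nlarge; have k0 : 0 < k by exact: ltnW.
pose V : finType := (bool * 'I_N)%type; pose m := l - k + 1.
have m2 : 2 <= m by rewrite /m; lia.
have ml : m <= l by rewrite /m; lia.
pose H : {set V} := [set v | v.1].
have half b : #|[set v : V | v.1 == b]| = N.
  rewrite (_ : [set v | _] = [set (b, i) | i : 'I_N]).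
    by rewrite card_imset ?card_ord // => i j [].
  apply/setP=> -[c i]; rewrite inE; apply/eqP/imsetP => [/= ->|[j _ [-> _]] //].
  by exists i.
have cH : #|H| = N by rewrite -(half true); apply: eq_card => v; rewrite !inE eqb_id.
have cH' : #|~: H| = N by rewrite -(half false); apply: eq_card => v; rewrite !inE eqbF_neg.
pose E0 := even_edges k H.
have [S0 S0H cS0] : exists2 S : {set V}, S \subset ~: H & #|S| = k.-1.
  exists [set x in take k.-1 (enum (~: H))].
    by apply/subsetP=> x; rewrite inE => /mem_take; rewrite mem_enum.
  by rewrite cardsE (card_uniqP (take_uniq _ (enum_uniq _))) size_takel // -cardE cH'; lia.
have [S1 S1H cS1] : exists2 S : {set V}, S :&: H != set0 & #|S| = k.-1.
  exists [set x in take k.-1 (enum H)].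
    rewrite (setIidPl _); last by apply/subsetP=> x; rewrite inE => /mem_take; rewrite mem_enum.
    rewrite -card_gt0 cardsE (card_uniqP (take_uniq _ (enum_uniq _))) size_takel // -?cardE ?cH; lia.
  by rewrite cardsE (card_uniqP (take_uniq _ (enum_uniq _))) size_takel // -cardE cH; lia.
pose A := [set e in E0 | e :&: H == set0].
pose B := [set e in E0 | e :&: H != set0].
(* [S0] avoids [H], so an edge over it has at most one vertex in [H], hence none; the degree of [S0]
   thus bounds [#|A|] from below. Likewise all edges over [S1] lie in [B]. *)
have degA : m <= #|A|.
  have d := codegree_even_edges k2 cH cH' cS0.
  apply: leq_trans (_ : degree E0 S0 <= _); first by move: d; rewrite -/E0; lia.
  apply: subset_leq_card; apply/subsetP=> e; rewrite in_set => /andP[eE sub].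
  rewrite in_set eE -cards_eq0 /=; have le : #|e :&: H| <= #|e :\: S0|.
    apply: subset_leq_card; apply/subsetP=> v /setIP[ve vH]; rewrite in_setD ve andbT.
    by apply: contraL vH => /(subsetP S0H); rewrite in_setC.
  move: eE le; rewrite in_set cardsD (setIidPr sub) cS0 => /andP[/eqP-> odd0] le.
  have {}le : #|e :&: H| <= 1 by lia.
  by move: odd0 le; case: #|_| => [|[|]].
have degB : m <= #|B|.
  have d := codegree_even_edges k2 cH cH' cS1.
  apply: leq_trans (_ : degree E0 S1 <= _); first by move: d; rewrite -/E0; lia.
  apply: subset_leq_card; apply/subsetP=> e; rewrite !inE => /andP[-> sub] /=.
  by apply: contra S1H => /eqP e0; rewrite -subset0 -e0 setSI.
have m0 : 0 < m by exact: ltnW.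
(* Residues 1 for [A'] and [m - 1] for [B']: the total is divisible by [m], while [#|A'|] is not,
   since [m >= 2]. *)
have [A' [A'A cA' dA']] := trim_card m0 m2 degA.
have pm : m.-1 < m by rewrite prednK.
have [B' [B'B cB' dB']] := trim_card m0 pm degB.
exists (A' :|: B').
have A'0 e : e \in A' -> e \in E0 /\ e :&: H = set0.
  by move/(subsetP A'A); rewrite inE => /andP[-> /eqP].
have B'0 e : e \in B' -> e \in E0 /\ e :&: H != set0.
  by move/(subsetP B'B); rewrite inE => /andP[].
have sE : A' :|: B' \subset E0.
  by apply/subsetP=> e /setUP[/A'0[]|/B'0[]].
have cE : #|A' :|: B'| = #|A'| + #|B'|.
  rewrite cardsU (_ : A' :&: B' = set0) ?cards0 ?subn0 //; apply/setP=> e; rewrite in_set0 in_setI.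
  by apply/negP => /andP[/A'0[_ e0] /B'0[_]]; rewrite e0 eqxx.
have E0D : E0 :\: (A' :|: B') \subset (A :\: A') :|: (B :\: B').
  apply/subsetP=> e; rewrite !(in_setU, in_setD) negb_or => /andP[/andP[-> ->] eE].
  by rewrite /= /A /B !inE -!/E0; move: eE; rewrite inE => ->; case: (_ == set0).
have cD : #|E0 :\: (A' :|: B')| <= 2 * l.
  apply: leq_trans (subset_leq_card E0D) _; apply: leq_trans (leq_card_setU _ _) _.
  by move: dA' dB' ml; clear; lia.
have degE (S : {set V}) : #|S| = k.-1 -> N - (k + 2 * l) <= degree (A' :|: B') S.
  move=> cS; have d := codegree_even_edges k2 cH cH' cS.
  have : degree E0 S <= degree (A' :|: B') S + #|E0 :\: (A' :|: B')|.
    apply: leq_trans (leq_card_setU _ _); apply: subset_leq_card; apply/subsetP=> e.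
    rewrite in_set in_setU in_setD [e \in [set _ in _ | _]]in_set => /andP[-> ->]; rewrite andbT.
    by case: (e \in _).
  by move: cD d; rewrite -/E0; clear; lia.
split.
- by move=> e /(subsetP sE) /even_edges_uniform.
- rewrite /path_divisible card_tight_path ?(ltnW kl) // cE -/m /dvdn -modnDm cA' cB' modnDm.
  by rewrite add1n prednK // modnn.
(* The initial value of the minimum is the number of edges, bounded below by the degree of [S0]. *)
- apply: le_big_minn => [|S /eqP]; last exact: degE.
  by apply: leq_trans (degE _ cS0) _; apply: subset_leq_card; apply/subsetP=> e; rewrite inE => /andP[].
- move=> D dD; have := no_decomposition (A := A') k2 (ltnW kl) sE _ dD.
  rewrite -/m /dvdn cA' modn_small // => H1; suff : false by []; apply: H1.
  apply/setP=> e; rewrite inE in_setU; have [eA'|_] := boolP (e \in A').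
    by have [_ ->] := A'0 _ eA'; rewrite eqxx.
  by apply/esym/negP => /andP[/B'0[_ /negPf->]].
Qed.

(** * The value of the threshold *)

Local Open Scope ring_scope.

Theorem theorem1p4 (R : realType) (k l : nat)
    (hk : (3 <= k)%N) (hl : (k + 1 <= l)%N) :
  is_decomposition_threshold k l (2^-1 : R).
Proof.
have k2 : (2 <= k)%N by exact: ltnW.
have kl : (k < l)%N by rewrite -addn1.
split; first by rewrite invr_gt0.
  by apply: half_forces_decomposition => //; exact: ltnW.
move=> d _ forces; rewrite leNgt; apply/negP => dlt.
pose eps : R := (2^-1 - d) / 2.
have eps0 : 0 < eps by rewrite /eps; lra.
have [n0 Hn0] := forces eps eps0.
pose C := (k + 2 * l)%N.
(* The first summand gives [C <= 2 * eps * N]; as [d + eps = 1/2 - eps], this makes [N - C] at least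
   [(d + eps) * (2 * N)]. The others meet the size conditions of [Hn0] and
   [two_class_hypergraph]. *)
pose N := (Num.bound (C%:R / (2 * eps)) + n0 + (2 * k + 4 * l))%N.
have [|E [uE dvdE degE noD]] := @two_class_hypergraph k l N k2 kl; first by rewrite leq_addl.
have cV : #|{: bool * 'I_N}| = (2 * N)%N by rewrite card_prod card_bool card_ord.
have [| |D dD] := Hn0 (bool * 'I_N)%type E uE _ dvdE.
- by rewrite cV /N; lia.
- rewrite cV; apply: le_trans (_ : (N - C)%:R <= _); last by rewrite ler_nat.
  rewrite natrB; last by rewrite /N /C; lia.
  have : C%:R / (2 * eps) <= N%:R :> R.
    apply: ltW; apply: lt_le_trans (archi_boundP _) _; first by rewrite divr_ge0 // mulr_ge0 // ltW.
    by rewrite ler_nat /N -addnA leq_addr.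
  have -> : d + eps = 2^-1 - eps by rewrite /eps; lra.
  have e2 : 0 < 2 * eps by lra.
  by rewrite (ler_pdivrMr _ _ e2) natrM; move: (eps) (N%:R) => x y; lra.
- exact: noD dD.
Qed.
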